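(* Let $n$ be a positive integer, and let $g_{\mathrm{mx}}(n):=(n-1)\cdot 2^{n-1}$ and $g_{\mathrm{sb}}(n):=(n-1)\cdot 2^{n-2}+2^{n-3}$. Then the following three assertions hold. (a) Let $A$ be an $n$-element congruence distributive algebra. Then $\mathrm{CE}(A)\le g_{\mathrm{mx}}(n)$. Furthermore, if $\mathrm{CE}(A)=g_{\mathrm{mx}}(n)$, then $\mathrm{Con}(A)$ is a boolean lattice and $|\mathrm{Con}(A)|=2^{n-1}$. (b) Let $L$ be an $n$-element lattice. Then $\mathrm{CE}(L)\le g_{\mathrm{mx}}(n)$. Furthermore, $\mathrm{CE}(L)=g_{\mathrm{mx}}(n)$ if and only if $L$ is the $n$-element chain. (c) Let $L$ be an $n$-element lattice such that $\mathrm{CE}(L)<g_{\mathrm{mx}}(n)$. Then $n\ge 4$ and $\mathrm{CE}(L)\le g_{\mathrm{sb}}(n)$. Furthermore, $\mathrm{CE}(L)=g_{\mathrm{sb}}(n)$ if and only if there is exactly one $2$-element antichain in $L$. Equivalently, $\mathrm{CE}(L)=g_{\mathrm{sb}}(n)$ if and only if there are finite chains $C'$ and $C''$ such that $L=C'+_{\mathrm{glu}}B_4+_{\mathrm{glu}}C''$.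
   Context: An algebra $A=(A,F)$ is a nonempty set $A$ with a set $F$ of finitary operations (of any type); $\mathrm{Con}(A)$ is its lattice of congruences, ordered by inclusion. $A$ is congruence distributive if the lattice $\mathrm{Con}(A)$ is distributive. A lattice is regarded as an algebra with the operations $\vee,\wedge$ (lattices are congruence distributive). Energy. Let $A=\{a_1,\dots,a_n\}$ be an $n$-element algebra and $\alpha\in\mathrm{Con}(A)$. The adjacency matrix of $\alpha$ is the symmetric real matrix $M(\alpha)=(m_{ij})_{n\times n}$ with $m_{ij}=1$ if $a_i\ne a_j$ and $(a_i,a_j)\in\alpha$, and $m_{ij}=0$ otherwise. Its characteristic polynomial factors as $\prod_{j=1}^n(x-x_j)$ with $x_1,\dots,x_n\in\mathbb{R}$, and the energy of $\alpha$ is $\mathrm{En}(\alpha):=\sum_{j=1}^n|x_j|$ (eigenvalues counted with multiplicity; this does not depend on the order in which the elements are listed). The congruence energy of the finite algebra $A$ is $\mathrm{CE}(A):=\sum_{\alpha\in\mathrm{Con}(A)}\mathrm{En}(\alpha)$. A chain is a (nonempty) lattice in which any two elements are comparable; a one-element chain is allowed. $B_4$ is the $4$-element boolean lattice. A $2$-element antichain is a set $\{x,y\}$ of two incomparable elements. The glued sum $U+_{\mathrm{glu}}V$ of disjoint finite lattices $U$ and $V$ is the lattice $(U\cup(V\setminus\{0_V\}),\le)$, where $0_V$ is the least element of $V$ and $x\le y$ iff $x\le_U y$, or $x\le_V y$, or $(x,y)\in U\times V$. Equality of lattices such as $L=C'+_{\mathrm{glu}}B_4+_{\mathrm{glu}}C''$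 is understood up to isomorphism. *)

(* Defs.v *)
From HB Require Import structures.
From mathcomp Require Import all_boot all_order all_algebra.
From mathcomp Require Import complex.
From mathcomp Require Import boolp reals.

Set Implicit Arguments.
Unset Strict Implicit.
Unset Printing Implicit Defensive.

Import Order.TTheory GRing.Theory Num.Theory.
Local Open Scope ring_scope.

Record operation (A : Type) := Operation {
  arity : nat;
  apply_op : arity.-tuple A -> A }.

Arguments apply_op {A} o t.

(* An algebra is a finite carrier A together with a set F of operations.
   F may be infinite, so membership in Con(A) is a Prop, made boolean below
   by classical reflection. *)
Definition is_congruence (A : finType) (F : operation A -> Prop)
    (r : {set A * A}) : Prop :=
  [/\ forall x, (x, x) \in r,
      forall x y, (x, y) \in r -> (y, x) \in r,
      forall x y z, (x, y) \in r -> (y, z) \in r -> (x, z) \in r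
    & forall f, F f -> forall s t : (arity f).-tuple A,
        (forall i, (tnth s i, tnth t i) \in r) ->
        (apply_op f s, apply_op f t) \in r].

Record Con (A : finType) (F : operation A -> Prop) := Congruence {
  con_graph :> {set A * A};
  _ : `[< is_congruence F con_graph >] }.

HB.instance Definition _ (A : finType) (F : operation A -> Prop) :=
  [isSub for @con_graph A F].
HB.instance Definition _ (A : finType) (F : operation A -> Prop) :=
  [Finite of Con F by <:].

Section ConLattice.
Context (A : finType) (F : operation A -> Prop).
Implicit Types a b c : Con F.

Lemma con_congruence a : is_congruence F a.
Proof. by case: a => r /= /asboolP. Qed.

Definition con_le a b := con_graph a \subset con_graph b.

Fact con_le_refl : reflexive con_le.
Proof. by move=> a; exact: subxx. Qed.

Fact con_le_anti : antisymmetric con_le.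
Proof. by move=> a b ab; apply/val_inj/eqP; rewrite eqEsubset. Qed.

Fact con_le_trans : transitive con_le.
Proof. by move=> b a c; exact: subset_trans. Qed.

Fact con_display : Order.disp_t. Proof. exact: Order.Disp tt tt. Qed.

HB.instance Definition _ := Order.Le_isPOrder.Build con_display (Con F)
  con_le_refl con_le_anti con_le_trans.

Fact con_meet_subproof a b :
  `[< is_congruence F (con_graph a :&: con_graph b)%SET >].
Proof.
apply/asboolP; case: (con_congruence a) (con_congruence b) => ar as_ at_ ac.
case=> br bs bt bc; split.
- by move=> x; rewrite inE ar br.
- by move=> x y; rewrite !inE => /andP[/as_-> /bs].
- by move=> x y z; rewrite !inE => /andP[xy xy'] /andP[yz yz'];
    rewrite (at_ x y z) // (bt x y z).
- move=> f Ff s t st; rewrite inE ac ?bc // => i;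
    by have /[!inE] /andP[] := st i.
Qed.
Definition con_meet a b := Congruence (con_meet_subproof a b).

Definition con_join_graph a b : {set A * A} :=
  [set p | [forall c : Con F,
     (con_graph a :|: con_graph b \subset con_graph c) ==> (p \in con_graph c)]].

Fact con_join_subproof a b : `[< is_congruence F (con_join_graph a b) >].
Proof.
apply/asboolP; split.
- move=> x; rewrite inE; apply/forallP => c; apply/implyP => _.
  by case: (con_congruence c).
- move=> x y; rewrite !inE => /forallP xy; apply/forallP => c; apply/implyP.
  by move=> /(implyP (xy c)); case: (con_congruence c) => _ + _ _; apply.
- move=> x y z; rewrite !inE => /forallP xy /forallP yz.
  apply/forallP => c; apply/implyP => abc.
  move: (implyP (xy c) abc) (implyP (yz c) abc).
  by case: (con_congruence c) => _ _ + _; apply.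
- move=> f Ff s t st; rewrite inE; apply/forallP => c; apply/implyP => abc.
  case: (con_congruence c) => _ _ _; apply=> // i.
  by have /[!inE] /forallP/(_ c)/implyP := st i; apply.
Qed.
Definition con_join a b := Congruence (con_join_subproof a b).

Fact con_meetP a b c :
  (a <= con_meet b c)%O = (a <= b)%O && (a <= c)%O.
Proof. exact: subsetI. Qed.

Fact con_joinP a b c :
  (con_join a b <= c)%O = (a <= c)%O && (b <= c)%O.
Proof.
rewrite -[RHS]/(_ && (con_graph b \subset con_graph c)) -subUset.
apply/idP/idP => [jc|abc].
  apply: (subset_trans _ jc); apply/subsetP => p p_ab; rewrite inE.
  by apply/forallP => e; apply/implyP => /subsetP; apply.
by apply/subsetP => p; rewrite inE => /forallP/(_ c)/implyP; apply.
Qed.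

HB.instance Definition _ := Order.POrder_MeetJoin_isLattice.Build
  con_display (Con F) con_meetP con_joinP.

Fact con_bot_subproof :
  `[< is_congruence F [set p : A * A | p.1 == p.2]%SET >].
Proof.
apply/asboolP; split=> [x|x y|x y z|f Ff s t st]; rewrite !inE //=.
- by rewrite eq_sym.
- by move=> /eqP-> /eqP->.
- by apply/eqP; congr apply_op; apply: eq_from_tnth => i;
    have /[!inE]/eqP := st i.
Qed.
Definition con_bot := Congruence con_bot_subproof.

Fact con_top_subproof : `[< is_congruence F [set: A * A]%SET >].
Proof. by apply/asboolP; split=> *; rewrite inE. Qed.
Definition con_top := Congruence con_top_subproof.

Fact con_botP a : (con_bot <= a)%O.
Proof.
apply/subsetP => -[x y]; rewrite inE /= => /eqP->.
by case: (con_congruence a).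
Qed.

Fact con_topP a : (a <= con_top)%O.
Proof. exact: subsetT. Qed.

HB.instance Definition _ :=
  Order.hasBottom.Build con_display (Con F) con_botP.
HB.instance Definition _ :=
  Order.hasTop.Build con_display (Con F) con_topP.

End ConLattice.

Definition distributive_lattice d (L : latticeType d) : Prop :=
  left_distributive (@Order.meet d L) (@Order.join d L).

Definition boolean_lattice d (L : tbLatticeType d) : Prop :=
  distributive_lattice L /\
  forall x : L, exists y : L,
    Order.meet x y = Order.bottom /\ Order.join x y = Order.top.

Definition congruence_distributive (A : finType) (F : operation A -> Prop) :=
  distributive_lattice (Con F).

Section Spectrum.
Context (R : rcfType).

Lemma char_poly_sim (K : fieldType) n (P D : 'M[K]_n) : P \in unitmx ->
  char_poly (invmx P *m D *m P) = char_poly D.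
Proof.
move=> Pu; rewrite /char_poly /char_poly_mx.
have -> : 'X%:M - map_mx polyC (invmx P *m D *m P) =
    map_mx polyC (invmx P) *m ('X%:M - map_mx polyC D) *m map_mx polyC P.
  rewrite mulmxBr mulmxBl -!map_mxM /=; congr (_ - _).
  by rewrite scalar_mxC -mulmxA -map_mxM mulVmx // map_mx1 mulmx1.
rewrite !det_mulmx mulrC mulrA -det_mulmx -map_mxM mulmxV //.
by rewrite map_mx1 det1 mul1r.
Qed.

Lemma char_poly_split_sym n (M : 'M[R]_n) : M^T = M ->
  exists s : seq R, char_poly M == \prod_(x <- s) ('X - x%:P).
Proof.
move=> Msym; pose toC := real_complex R; pose MC := map_mx toC M.
have MCherm : MC \is hermsymmx.
  apply: realsym_hermsym.
    apply/is_hermitianmxP; rewrite expr0 scale1r map_mx_id //.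
    by apply/matrixP => i j; rewrite !mxE -[in LHS]Msym mxE.
  by apply/mxOverP => i j; rewrite mxE; apply/complex_realP; exists (M i j).
have /orthomx_spectralP eM := hermitian_normalmx MCherm.
have Dr := hermitian_spectral_diag_real MCherm.
set D := spectral_diag MC in eM Dr.
exists [seq complex.Re (D 0 i) | i <- enum 'I_n]; apply/eqP.
apply: (map_inj_poly (@complexI R)) => //.
rewrite map_char_poly [map_mx _ _]eM char_poly_sim ?spectral_unit //.
rewrite char_poly_trig ?diag_mx_is_trig // rmorph_prod big_map big_enum /=.
apply: eq_bigr => i _; rewrite rmorphB /= map_polyX map_polyC /= mxE eqxx mulr1n.
by congr ('X - _%:P); rewrite -[LHS](RRe_real) // (mxOverP Dr).
Qed.

End Spectrum.

Section Energy.
Context (R : realType) (A : finType) (F : operation A -> Prop).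

(* The elements of A are listed as enum_val 0, enum_val 1, ... *)
Definition con_adjacency (a : Con F) : 'M[R]_#|A| :=
  \matrix_(i, j)
    ((enum_val i != enum_val j) && ((enum_val i, enum_val j) \in con_graph a))%:R.

Lemma con_adjacency_sym a : (con_adjacency a)^T = con_adjacency a.
Proof.
apply/matrixP => i j; rewrite !mxE eq_sym; congr (_ && _)%:R.
by case: (con_congruence a) => _ s _ _; apply/idP/idP; apply: s.
Qed.

Definition con_spectrum (a : Con F) : seq R :=
  xchoose (char_poly_split_sym (con_adjacency_sym a)).

Lemma con_spectrumP a :
  char_poly (con_adjacency a) = \prod_(x <- con_spectrum a) ('X - x%:P).
Proof. exact/eqP/(xchooseP (char_poly_split_sym (con_adjacency_sym a))). Qed.

Definition energy (a : Con F) : R := \sum_(x <- con_spectrum a) `|x|.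

Definition congruence_energy : R := \sum_(a : Con F) energy a.

End Energy.

Arguments congruence_energy R {A} F.

Definition join_op d (L : latticeType d) : operation L :=
  Operation (fun t : 2.-tuple L => Order.join (tnth t ord0) (tnth t ord_max)).

Definition meet_op d (L : latticeType d) : operation L :=
  Operation (fun t : 2.-tuple L => Order.meet (tnth t ord0) (tnth t ord_max)).

Definition lattice_ops d (L : latticeType d) : operation L -> Prop :=
  fun f => f = join_op L \/ f = meet_op L.

Arguments join_op {d} L.
Arguments meet_op {d} L.
Arguments lattice_ops {d} L.

Definition is_chain d (L : latticeType d) : Prop :=
  forall x y : L, (x >=< y)%O.

Definition antichain2 d (L : finLatticeType d) (X : {set L}) : Prop :=
  exists x y : L, (x >< y)%O /\ X = [set x; y]%SET.

Definition lattice_isomorphic d (L : latticeType d) d' (K : latticeType d') :=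
  exists f : L -> K,
    [/\ bijective f, {morph f : x y / Order.meet x y >-> Order.meet x y}
      & {morph f : x y / Order.join x y >-> Order.join x y}].

Definition glued_sum dU (U : finTBLatticeType dU) dV (V : finTBLatticeType dV) :=
  (U + {v : V | v != \bot%O})%type.

Section GluedSum.
Context dU (U : finTBLatticeType dU) dV (V : finTBLatticeType dV).
Local Notation G := (glued_sum U V).

HB.instance Definition _ := Finite.on G.

Fact glued_display : Order.disp_t. Proof. exact: Order.Disp tt tt. Qed.

Definition glued_le (x y : G) : bool :=
  match x, y with
  | inl u, inl u' => (u <= u')%O
  | inl _, inr _ => true
  | inr _, inl _ => false
  | inr v, inr v' => (val v <= val v')%O
  end.

Fact glued_le_refl : reflexive glued_le.
Proof. by case=> x /=. Qed.

Fact glued_le_anti : antisymmetric glued_le.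
Proof.
case=> x [] y //= /le_anti; first by move->.
by move/val_inj->.
Qed.

Fact glued_le_trans : transitive glued_le.
Proof. by case=> y [] x [] z //=; exact: le_trans. Qed.

HB.instance Definition _ := Order.Le_isPOrder.Build glued_display G
  glued_le_refl glued_le_anti glued_le_trans.

(* 0_V is not in the glued sum; the top of U takes over its role, e.g. as the
   meet of v and v' when their meet in V is 0_V. *)
Definition glued_inr (v : V) : G :=
  if insub v is Some v' then inr v' else inl \top%O.

Variant glued_inr_spec (v : V) : G -> Type :=
  | GluedInrBot of v = \bot%O : glued_inr_spec v (inl \top%O)
  | GluedInr (v' : {v : V | v != \bot%O}) of v = val v' :
      glued_inr_spec v (inr v').

Fact glued_inrP v : glued_inr_spec v (glued_inr v).
Proof.
rewrite /glued_inr; case: (insubP {v : V | v != \bot%O} v) => [v' _ <-|].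
  exact: GluedInr.
by move=> /negPn/eqP; exact: GluedInrBot.
Qed.

Definition glued_meet (x y : G) : G :=
  match x, y with
  | inl u, inl u' => inl (Order.meet u u')
  | inl u, inr _ => inl u
  | inr _, inl u => inl u
  | inr v, inr v' => glued_inr (Order.meet (val v) (val v'))
  end.

Definition glued_join (x y : G) : G :=
  match x, y with
  | inl u, inl u' => inl (Order.join u u')
  | inl _, inr v => inr v
  | inr v, inl _ => inr v
  | inr v, inr v' => glued_inr (Order.join (val v) (val v'))
  end.

Fact glued_meetP x y z : (x <= glued_meet y z)%O = (x <= y)%O && (x <= z)%O.
Proof.
rewrite -![(_ <= _)%O]/(glued_le _ _).
case: y z => [y|y] [z|z]; case: x => [x|x] //=; rewrite ?andbT ?andbF ?lexI //.
- by case: glued_inrP => //= _; rewrite lex1.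
- rewrite -lexI; case: glued_inrP => [->|v -> //].
  by rewrite /= lex0 (negbTE (valP x)).
Qed.

Fact glued_joinP x y z : (glued_join x y <= z)%O = (x <= z)%O && (y <= z)%O.
Proof.
rewrite -![(_ <= _)%O]/(glued_le _ _).
case: x y => [x|x] [y|y] /=;
  try by case: z => [z|z] //=; rewrite ?andbF ?andbT ?leUx.
case: glued_inrP => [/eqP|v]; first by rewrite join_eq0 (negbTE (valP x)).
by case: z => [z|z] //= <-; rewrite leUx.
Qed.

HB.instance Definition _ := Order.POrder_MeetJoin_isLattice.Build
  glued_display G glued_meetP glued_joinP.

Fact glued_botP (x : G) : (inl \bot%O <= x :> G)%O.
Proof. by case: x => x //; exact: le0x. Qed.

Fact glued_topP (x : G) : (x <= glued_inr \top%O)%O.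
Proof.
rewrite -[(_ <= _)%O]/(glued_le _ _); case: x => x.
  by case: glued_inrP => //= _; exact: lex1.
case: glued_inrP => [e|v e] /=; last by rewrite -e lex1.
by have := lex1 (val x); rewrite e lex0 (negbTE (valP x)).
Qed.

HB.instance Definition _ := Order.hasBottom.Build glued_display G glued_botP.
HB.instance Definition _ := Order.hasTop.Build glued_display G glued_topP.

End GluedSum.

Notation "U +glu V" := (glued_sum U V) (at level 50, left associativity)
  : type_scope.

Definition B4 : Type := (bool *p bool)%type.

Definition g_mx (R : realType) (n : nat) : R := (n%:R - 1) * 2 ^ (n%:Z - 1).

(* The exponents are integers: 2 ^ (n - 3) is a fraction for n < 3. *)
Definition g_sb (R : realType) (n : nat) : R :=
  (n%:R - 1) * 2 ^ (n%:Z - 2) + 2 ^ (n%:Z - 3).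

(* Main.v *)
From HB Require Import structures.
Require Import Defs.
From mathcomp Require Import all_boot all_order all_algebra.
From mathcomp Require Import reals zify.
Import Order.TTheory GRing.Theory Num.Theory.
Set Implicit Arguments.
Unset Strict Implicit.
Unset Printing Implicit Defensive.

(** The adjacency matrix of a congruence [a] is [Q Q^T - 1] for the incidence
    matrix [Q] of elements and block representatives, hence
    [En(a) = 2 (n - number of blocks)] and everything is about the sum of the
    ranks [r(a) = n - number of blocks].

    If [Con(A)] is distributive with set [J] of join irreducible elements, then
    [r] increases strictly along chains, so [r(b) - r(a)] is at least the number
    of elements of [J] below [b] and not below [a]; in particular
    [#|J| <= n - 1]. If [#|J| < n - 1], then [Con(A)] is too small to reach the
    bound; otherwise [r(a)] is the number of elements of [J] below [a], and the
    sum of the sizes of some subsets of [J] is at most [(n - 1) 2 ^ (n - 2)],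
    with equality only if all nonempty subsets occur.

    For a lattice [L] with set [J] of join irreducible elements, [r(a)] counts
    the elements that are not least in their block, and [a] is determined by the
    set [I_a] of those that lie in [J]. If [L] has incomparable elements [u] and
    [v], then [#|J| <= n - 2], and [#|J| < n - 2] makes [Con(L)] too small. If
    [#|J| = n - 2], then [u \/ v] is the only reducible element besides the least
    one, and it is least in its block unless [I_a] meets [{u, v}]. Hence the sum
    of the ranks is at most the sum over all subsets [I] of [J] of
    [#|I| + (1 if I meets {u, v})]. In case of equality [I_a = {u}] and
    [I_a = {v}] occur, and every antichain must meet both. Conversely, if the
    join irreducible elements are join prime, then all subsets of [J] occur. *)

(** * Spectrum and energy of a congruence *)

Section Energy.
Local Open Scope ring_scope.

(** The block matrix with blocks [y], [A], [B], [1] is made triangular from the right and from the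
    left. The second reduction puts a factor [y ^ n] on both sides, which cancels since [y != 0]. *)
Lemma det_scalar_sub_mulC (D : idomainType) n (y : D) (A B : 'M[D]_n) :
  y != 0 -> \det (y%:M - A *m B) = \det (y%:M - B *m A).
Proof.
move=> y0; pose M := block_mx y%:M A B 1%:M.
have dM : \det M = \det (y%:M - A *m B).
  have := det_mulmx M (block_mx 1%:M 0 (- B) 1%:M).
  rewrite mulmx_block det_lblock !det1 !mulr1 !mulmx1 !mulmx0 !add0r.
  by rewrite mul1mx subrr mulmxN det_ublock det1 mulr1 => <-.
have := det_mulmx (block_mx 1%:M 0 (- B) y%:M) M.
rewrite mulmx_block det_lblock det1 mul1r !mul1mx !mul0mx !addr0 !mulmx1.
rewrite mulNmx -scalar_mxC addNr det_ublock dM mulNmx [- _ + _]addrC.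
by rewrite det_scalar => /(mulfI (expf_neq0 _ y0)).
Qed.

Section EnergyRep.
Context (R : realType) (A : finType) (F : operation A -> Prop) (a : Con F).
Variable rep : A -> A.
Hypothesis rep_rel : forall x, (x, rep x) \in con_graph a.
Hypothesis rep_eq : forall x y, (x, y) \in con_graph a -> rep x = rep y.

Let repK x : rep (rep x) = rep x.
Proof. exact/esym/rep_eq/rep_rel. Qed.

Let mem_rep x y : ((x, y) \in con_graph a) = (rep x == rep y).
Proof.
have [_ as_ at_ _] := con_congruence a.
apply/idP/eqP => [/rep_eq // | e]; apply: at_ (rep_rel x) _.
by rewrite e; apply: as_.
Qed.

(** The size of the block of [x] if [x] is a representative, and 0 otherwise. *)
Let fiber x := #|[set y | rep y == x]|.

(* The adjacency matrix is [Q Q^T - 1] where [Q] is the incidence matrix of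
   elements and representatives, while [Q^T Q] is diagonal. *)
Let char_poly_adjacency :
  char_poly (con_adjacency R a) = \prod_x ('X - ((fiber x)%:R - 1 : R)%:P).
Proof.
pose Q : 'M[R]_#|A| := \matrix_(i, j) (rep (enum_val i) == enum_val j)%:R.
have adjE : con_adjacency R a = Q *m Q^T - 1%:M.
  apply/matrixP => i j; rewrite !mxE mem_rep.
  under eq_bigr do rewrite !mxE.
  rewrite (bigD1 (enum_rank (rep (enum_val i)))) //= enum_rankK eqxx mul1r.
  rewrite big1 ?addr0 => [|k ki]; last first.
    case: eqP => [e|_]; last by rewrite mul0r.
    by rewrite e enum_valK eqxx in ki.
  rewrite (inj_eq enum_val_inj) [rep (enum_val j) == _]eq_sym.
  by case: eqP => [->|_] /=; rewrite ?eqxx ?subrr ?subr0.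
have QTQ : Q^T *m Q = diag_mx (\row_(j < #|A|) (fiber (enum_val j))%:R).
  apply/matrixP => i j; rewrite !mxE.
  under eq_bigr do rewrite !mxE.
  have [->|ij] := eqVneq i j; last first.
    rewrite mulr0n big1 // => k _; case: eqP => [->|_]; last by rewrite mul0r.
    by rewrite (inj_eq enum_val_inj) (negPf ij) mulr0.
  rewrite mulr1n /fiber -sum1_card natr_sum.
  rewrite [RHS](reindex_onto enum_val enum_rank) => [|x _] /=; last exact: enum_rankK.
  rewrite [RHS]big_mkcond; apply: eq_bigr => k _.
  by rewrite inE enum_valK eqxx andbT; case: eqP => _; rewrite ?mulr1 ?mulr0.
rewrite /char_poly /char_poly_mx adjE.
(* The shifted variable ['X + 1] absorbs the subtracted identity matrix. *)
pose Qp := map_mx polyC Q; pose y : {poly R} := 'X + 1.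
have -> : 'X%:M - map_mx polyC (Q *m Q^T - 1%:M) = y%:M - Qp *m Qp^T.
  rewrite map_mxB map_mxM map_mx1 map_trmx /y.
  by rewrite opprB addrA -[RHS]/(_ - _) (raddfD (@scalar_mx _ _)).
have y0 : y != 0 by rewrite -size_poly_eq0 size_XaddC.
rewrite det_scalar_sub_mulC // map_trmx -map_mxM QTQ map_diag_mx.
have -> : y%:M - diag_mx (map_mx polyC (\row_(j < #|A|) (fiber (enum_val j))%:R))
    = diag_mx (\row_(j < #|A|) (y - (fiber (enum_val j))%:R)).
  apply/matrixP => i j; rewrite !mxE polyC_natr.
  by case: eqP; rewrite ?subr0 // !mulr0n subr0.
rewrite det_diag (reindex_onto (fun i : 'I_#|A| => enum_val i) enum_rank) => [|x _] /=;
  last exact: enum_rankK.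
apply: eq_big => [k|k _]; first by rewrite enum_valK eqxx.
by rewrite !mxE polyCB polyC_natr opprB addrA.
Qed.

(** The eigenvalues [fiber x - 1] add up to 0, because the fibers partition [A]. Only those of
    nonrepresentatives are negative, namely -1, so absolute values add 2 for each of them. *)
Lemma energy_rep : energy R a = (2 * #|[set x | rep x != x]|)%:R.
Proof.
have pe : perm_eq (con_spectrum R a) [seq (fiber x)%:R - 1 | x : A].
  apply: prod_XsubC_eq.
  by rewrite -con_spectrumP char_poly_adjacency big_map big_enum.
rewrite /energy (perm_big _ pe) big_map big_enum /=.
have normE x : `|(fiber x)%:R - 1 : R| =
    (fiber x)%:R - 1 + (2 * (rep x != x))%:R.
  case: eqP => [e|ne] /=.
    rewrite addr0 ger0_norm // subr_ge0 ler1n card_gt0; apply/set0Pn.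
    by exists x; rewrite inE e.
  suff -> : fiber x = 0%N by rewrite sub0r normrN normr1 addrC addrK.
  apply/eqP; rewrite cards_eq0; apply/eqP/setP => z; rewrite !inE.
  by apply/eqP => zx; apply: ne; rewrite -zx repK.
rewrite (eq_bigr _ (fun x _ => normE x)) !big_split /= -!natr_sum sumrN.
have -> : (\sum_x fiber x = #|A|)%N.
  under eq_bigr do rewrite /fiber -sum1_card.
  rewrite -sum1_card [RHS](partition_big rep predT) //=.
  by apply: eq_bigr => x _; apply: eq_bigl => y; rewrite inE.
rewrite sumr_const subrr add0r -big_distrr /=.
congr ((2 * _)%N%:R); rewrite -sum1_card [RHS]big_mkcond.
by apply: eq_bigr => x _; rewrite inE; case: eqP.
Qed.

End EnergyRep.

End Energy.

(** * Join irreducible elements and ranks in distributive lattices *)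

(** Each [I] is paired with its complement in [J]; the two sizes add up to [#|J|]. *)
Lemma sum_card_powerset (T : finType) (J : {set T}) :
  (2 * \sum_(I in powerset J) #|I| = #|J| * 2 ^ #|J|)%N.
Proof.
have -> : (2 * \sum_(I in powerset J) #|I| =
    \sum_(I in powerset J) (#|I| + #|J :\: I|))%N.
  rewrite big_split /= mul2n -addnn; congr addn.
  rewrite (reindex_onto (fun I => J :\: I) (fun I => J :\: I)) /= => [|I].
    apply: eq_bigl => I; rewrite !powersetE subsetDl setDDr setDv set0U.
    by apply/eqP/idP => [<-|/setIidPr //]; exact: subsetIl.
  by rewrite powersetE setDDr setDv set0U => /setIidPr.
rewrite -card_powerset mulnC -sum_nat_const; apply: eq_bigr => I.
by rewrite powersetE => IJ; have := subset_leq_card IJ; rewrite cardsDS //; lia.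
Qed.

(** The sets that avoid both [x] and [y] are the subsets of [J :\: [set x; y]], a quarter of all. *)
Lemma card_powerset_pair (T : finType) (J : {set T}) x y :
  x \in J -> y \in J -> x != y ->
  (4 * #|[set I in powerset J | (x \in I) || (y \in I)]| = 3 * 2 ^ #|J|)%N.
Proof.
move=> xJ yJ xy; set K := [set I in _ | _].
have xyJ : [set x; y] \subset J by rewrite subUset !sub1set xJ.
have KE : powerset J :\: K = powerset (J :\: [set x; y]).
  apply/setP => I; rewrite !inE subsetD negb_and negb_or.
  case: (I \subset J) => //=; rewrite andbT disjoint_sym.
  by rewrite disjoints_subset subUset !sub1set !inE.
have KP : K \subset powerset J by apply/subsetP => I; rewrite inE => /andP[].
have := cardsDS KP; rewrite KE !card_powerset cardsDS // cards2 xy.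
have := subset_leq_card KP; rewrite card_powerset.
have := subset_leq_card xyJ; rewrite cards2 xy.
case: #|J| => [|[|k]] // _; rewrite !subSS subn0 !expnS; lia.
Qed.

(** Serves to compare a sum over congruences with one over all sets of join irreducible elements. In
    case of equality the indices missed by [f] contribute nothing, so every index of positive weight
    is hit. *)
Lemma leq_sum_inj (T S : finType) (P : {set S}) (f : T -> S)
    (w : T -> nat) (g : S -> nat) :
  injective f -> (forall t, f t \in P) -> (forall t, w t <= g (f t))%N ->
  (\sum_t w t <= \sum_(s in P) g s)%N /\
  ((\sum_t w t = \sum_(s in P) g s)%N ->
     forall s, s \in P -> (0 < g s)%N ->
     exists2 t, s = f t & w t = g s).
Proof.
move=> f_inj fP wg.
have imP : f @: T \subset P by apply/subsetP => _ /imsetP[t _ ->].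
have sumE : (\sum_(s in P) g s =
    \sum_t g (f t) + \sum_(s in P :\: f @: T) g s)%N.
  rewrite (big_setID (f @: T)) /= (setIidPr imP) big_imset //= => t u _ _.
  exact: f_inj.
have [le_w eq_w] := leqif_sum (fun t (_ : predT t) =>
  conj (wg t) (erefl (w t == g (f t)))).
have {}le_w : (\sum_t w t <= \sum_t g (f t))%N by [].
rewrite sumE; split=> [|e s sP gs]; first by rewrite (leq_trans le_w) ?leq_addr.
have e1 : (\sum_t w t = \sum_t g (f t))%N by lia.
have e2 : (\sum_(s in P :\: f @: T) g s = 0)%N by lia.
have [/imsetP[t _ st]|sN] := boolP (s \in f @: T).
  exists t => //; move/eqP: e1; rewrite eq_w => /forallP/(_ t)/eqP ->.
  by rewrite -st.
move/eqP: e2; rewrite sum_nat_eq0 => /forallP/(_ s).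
by rewrite inE sN sP /=; case: (g s) gs.
Qed.

Section JoinIrreducible.
Context {d : Order.disp_t} {L : finLatticeType d}.
Implicit Types p q u v w : L.
Local Open Scope order_scope.

Lemma exists_minimal (P : pred L) u :
  P u -> exists2 m, P m & forall w, w < m -> ~~ P w.
Proof.
move=> Pu; pose h v := #|[set w | w <= v]|.
case: (arg_minnP h Pu) => m Pm min; exists m => // w wm; apply/negP => /min.
rewrite leqNgt => /negP[]; apply: proper_card; apply/properP; split.
  by apply/subsetP => v; rewrite !inE => /le_trans -> //; exact: ltW.
by exists m; rewrite inE // lt_geF.
Qed.

Definition greatest_below p q := (q < p) && [forall w, (w < p) ==> (w <= q)].

(** In a finite lattice this excludes the least element and the joins of two strictly smaller
    elements, and nothing else. *)
Definition join_irr p := [exists q, greatest_below p q].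

(* Junk value [p] when [p] is not join irreducible. *)
Definition lower_cover p := odflt p [pick q | greatest_below p q].

Definition JI := [set p | join_irr p].

Lemma lower_coverP p : join_irr p ->
  lower_cover p < p /\ forall w, w < p -> w <= lower_cover p.
Proof.
rewrite /join_irr /lower_cover => /existsP[q0 Hq0].
case: pickP => [q /andP[qp /forallP qw] /=|/(_ q0)]; last by rewrite Hq0.
by split=> // w; exact/implyP.
Qed.

Lemma join_irr_join p u v : join_irr p -> u < p -> v < p -> Order.join u v < p.
Proof.
move=> /lower_coverP[cp cov] up vp; apply: le_lt_trans cp.
by rewrite leUx !cov.
Qed.

(** Let [m] have the largest principal ideal among the elements strictly below [p]. Some [w < p] not
    below [m] would give an element [m \/ w < p] with a larger one. *)
Lemma join_irrI p u : u < p ->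
  (forall v w, v < p -> w < p -> Order.join v w < p) -> join_irr p.
Proof.
move=> up join_lt; pose h v := #|[set w | w <= v]|.
case: (@arg_maxnP _ u (fun v => v < p) h up) => m /= mp max; apply/existsP; exists m.
rewrite /greatest_below mp; apply/forallP => w; apply/implyP => wp.
apply/negbNE/negP => wm; have /max := join_lt _ _ mp wp.
rewrite leqNgt => /negP[]; apply: proper_card; apply/properP; split.
  by apply/subsetP => v; rewrite !inE => /le_trans -> //; exact: leUl.
by exists w; rewrite inE ?leUr.
Qed.

Lemma join_irrPn p : ~~ join_irr p ->
  (forall w, p <= w) \/ exists u v, [/\ u < p, v < p & Order.join u v = p].
Proof.
move=> pN; have [/existsP[u up]|/existsPn min] := boolP [exists u, u < p].
  right; have [/existsP[v /existsP[w /and3P[vp wp /eqP e]]]|no] :=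
    boolP [exists v, [exists w, [&& v < p, w < p & Order.join v w == p]]].
    by exists v, w.
  case/negP: pN; apply: (join_irrI up) => v w vp wp.
  rewrite lt_neqAle leUx !ltW // !andbT; apply: contraNneq no => e.
  by apply/existsP; exists v; apply/existsP; exists w; rewrite vp wp e eqxx.
left=> w; have := min (Order.meet p w); rewrite lt_neqAle leIl andbT negbK.
by move/eqP <-; exact: leIr.
Qed.

(** Otherwise take a minimal [m] that is below [x] but not below [y]. All smaller elements are under
    [y], hence so are their joins, which therefore differ from [m]; thus [m] is join irreducible. *)
Lemma le_JI x y : (forall p, join_irr p -> p <= x -> p <= y) -> x <= y.
Proof.
move=> sub; apply/negbNE/negP => xy.
have [|m /andP[mx my] min] := @exists_minimal (fun u => (u <= x) && ~~ (u <= y)) x.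
  by rewrite lexx.
have below w : w < m -> w <= y.
  move=> wm; have := min _ wm.
  by rewrite (le_trans (ltW wm) mx) /= negbK.
have m_irr : join_irr m.
  apply: (@join_irrI _ (Order.meet m y)).
    by rewrite lt_neqAle leIl andbT; apply: contraNneq my => <-; exact: leIr.
  move=> v w vm wm; rewrite lt_neqAle leUx !ltW // !andbT.
  by apply: contraNneq my => <-; rewrite leUx !below.
by rewrite (sub m) in my.
Qed.

Definition JI_below x := [set p in JI | p <= x].

Lemma JI_below_inj : injective JI_below.
Proof.
move=> x y /setP e; apply: le_anti; apply/andP; split;
  by apply: le_JI => p pI px; have := e p; rewrite !inE pI px //= => ->.
Qed.

Lemma JI_below_sub x : JI_below x \in powerset JI.
Proof. by rewrite powersetE; apply/subsetP => p; rewrite inE => /andP[]. Qed.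

Definition join_prime p :=
  forall u v, p <= Order.join u v -> (p <= u) || (p <= v).

(** By distributivity [p] is the join of [u /\ p] and [v /\ p], which cannot both be strictly below
    a join irreducible [p]. *)
Lemma distributive_join_prime p :
  distributive_lattice L -> join_irr p -> join_prime p.
Proof.
move=> dL pI u v puv; apply/negbNE/negP; rewrite negb_or => /andP[pu pv].
have: Order.join (Order.meet u p) (Order.meet v p) < p.
  apply: join_irr_join => //; rewrite lt_neqAle leIr andbT.
    by apply: contraNneq pu => <-; exact: leIl.
  by apply: contraNneq pv => <-; exact: leIl.
by rewrite -dL (meet_r puv) ltxx.
Qed.

End JoinIrreducible.
Arguments JI {d} L.

(** * Strictly increasing rank functions on finite distributive lattices *)

Section DistributiveRank.
Context (d : Order.disp_t) (D : finTBLatticeType d) (r : D -> nat) (m : nat).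
Hypothesis distrD : distributive_lattice D.
Hypothesis r_lt : {homo r : x y / (x < y)%O >-> (x < y)%N}.
Hypothesis r_bot : r \bot%O = 0%N.
Hypothesis r_top : (r \top%O <= m)%N.
Local Open Scope order_scope.

(** By induction on the size of the difference: joining to [x] a minimal join irreducible element
    [j] of the difference adds only [j] to the set below, while [r] grows by at least 1. *)
Lemma rank_JI_below (x y : D) :
  x <= y -> (r x + #|JI_below y :\: JI_below x| <= r y)%N.
Proof.
move: {2}#|_| (leqnn #|JI_below y :\: JI_below x|) => k.
elim: k x => [|k IH] x le_k xy.
  move: le_k; rewrite leqn0 => /eqP ->; rewrite addn0.
  by move: xy; rewrite le_eqVlt => /orP[/eqP->//|/r_lt/ltnW].
have [->|/set0Pn[j0 j0P]] := eqVneq (JI_below y :\: JI_below x) set0.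
  rewrite cards0 addn0; move: xy.
  by rewrite le_eqVlt => /orP[/eqP->//|/r_lt/ltnW].
have [j] := @exists_minimal _ D (mem (JI_below y :\: JI_below x)) _ j0P.
rewrite !inE negb_and => /andP[+ /andP[jI jy]] min; rewrite jI /= => jx.
have xj : x < Order.join x j.
  by rewrite lt_neqAle leUl andbT; apply: contraNneq jx => ->; exact: leUr.
(* By primality, a join irreducible [p] below [x \/ j] is below [x] or below [j]; if [p < j], then
   minimality of [j] puts it below [x]. *)
have JE : JI_below (Order.join x j) = j |: JI_below x.
  apply/setP => p; rewrite !inE; have [->|pj] := eqVneq p j.
    by rewrite jI leUr.
  rewrite /=; case pI: (join_irr p) => //=; apply/idP/idP => [pxj|px].
    have /orP[//|pj'] := distributive_join_prime distrD pI pxj.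
    have := min p; rewrite lt_neqAle pj pj' !inE pI /= negb_and negbK => /(_ isT).
    by rewrite (le_trans pj' jy) orbF.
  exact: le_trans px (leUl _ _).
have jn : j \in JI_below y :\: JI_below x by rewrite !inE jI jx jy.
have cE : #|JI_below y :\: JI_below x| = #|JI_below y :\: JI_below (Order.join x j)|.+1.
  rewrite JE (cardsD1 j) jn; congr _.+1; apply: eq_card => z.
  by rewrite !inE negb_or andbA.
have := IH (Order.join x j); rewrite leUx xy jy => /(_ _ isT).
rewrite cE in le_k *; have := r_lt xj; lia.
Qed.

Lemma sum_rank_distributive :
  (2 * \sum_x r x <= m * 2 ^ m)%N /\
  ((2 * \sum_x r x = m * 2 ^ m)%N ->
   boolean_lattice D /\ #|{: D}| = (2 ^ m)%N).
Proof.
have below_bot : JI_below \bot = set0 :> {set D}.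
  apply/setP => p; rewrite !inE lex0; case: eqP => [->|]; rewrite ?andbF ?andbT //.
  by apply/existsP => -[q /andP[]]; rewrite ltx0.
have below_top : JI_below \top = JI D.
  by apply/setP => p; rewrite !inE lex1 andbT.
have le_m : (#|JI D| <= m)%N.
  have := rank_JI_below (le0x (\top : D)).
  by rewrite below_bot below_top setD0 r_bot => /leq_trans; exact.
have cardD : (#|{: D}| <= 2 ^ #|JI D|)%N.
  rewrite -card_powerset -(card_imset _ (@JI_below_inj _ D)).
  by apply/subset_leq_card/subsetP => _ /imsetP[x _ ->]; exact: JI_below_sub.
have rm x : (r x <= m)%N.
  apply: leq_trans r_top; have := lex1 x; rewrite le_eqVlt.
  by case/orP => [/eqP->//|/r_lt/ltnW].
(* With fewer than [m] join irreducible elements, [D] has at most [2 ^ (m - 1)] elements; the bottom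
   has rank 0 and the others at most [m]. *)
move: le_m; rewrite leq_eqVlt => /orP[/eqP km|km]; last first.
  suff: (2 * \sum_x r x < m * 2 ^ m)%N by lia.
  have : (\sum_x r x <= #|{: D}|.-1 * m)%N.
    rewrite (bigD1 \bot) //= r_bot add0n -(cardC1 (\bot : D)) -sum_nat_const.
    by apply: leq_sum => x _.
  case: m km => [|m'] //; rewrite ltnS => /(leq_pexp2l (isT : 0 < 2)%N).
  move/(leq_trans cardD); rewrite expnS.
  have := expn_gt0 2 m'; move: (2 ^ m')%N => e; move: #|_| => c; nia.
(* From [x] up to the top the rank grows by at least the number of join irreducible elements not
   below [x]. *)
have r_le x : (r x <= #|JI_below x|)%N.
  have := rank_JI_below (lex1 x); rewrite below_top cardsDS ?km; last first.
    by rewrite -powersetE; exact: JI_below_sub.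
  have : (#|JI_below x| <= m)%N.
    by rewrite -km subset_leq_card // -powersetE; exact: JI_below_sub.
  lia.
have [le_r eq_r] := leq_sum_inj (g := fun I : {set D} => #|I|)
  (@JI_below_inj _ D) (@JI_below_sub _ D) r_le.
have := sum_card_powerset (JI D); rewrite km => sE.
split=> [|e]; first by rewrite -sE leq_mul2l.
have onto (I : {set D}) : I \subset JI D -> exists x, I = JI_below x.
  (* The empty set has weight 0, so equality of the sums does not reach it; it comes from the
     bottom. *)
  move=> IJ; have [->|I0] := eqVneq I set0; first by exists \bot.
  have /eq_r/(_ I) : (\sum_x r x = \sum_(I in powerset (JI D)) #|I|)%N by lia.
  by rewrite powersetE card_gt0 => /(_ IJ I0)[x -> _]; exists x.
split; last first.
  rewrite -km -card_powerset -(card_imset _ (@JI_below_inj _ D)).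
  congr #|pred_of_set _|; apply/setP => I; rewrite powersetE.
  apply/imsetP/idP => [[x _ ->]|/onto[x ->]]; last by exists x.
  by rewrite -powersetE JI_below_sub.
(* The complement of [x] is the element above exactly those join irreducible elements that are not
   below [x]. *)
split=> // x; have [y yE] := onto (JI D :\: JI_below x) (subsetDl _ _).
exists y; split; apply: le_anti.
  rewrite le0x andbT; apply: le_JI => p pI; rewrite lexI => /andP[px py].
  by move/setP/(_ p): yE; rewrite !inE pI px py.
rewrite lex1 /=; apply: le_JI => p pI _.
move/setP/(_ p): yE; rewrite !inE pI andbT /=.
case: (boolP (p <= x)) => [px _|_ /= /esym py]; first exact: le_trans px (leUl _ _).
exact: le_trans py (leUr _ _).
Qed.

End DistributiveRank.

(** * Congruences of finite lattices *)

Lemma sum_bij (T S : finType) (P : {set S}) (f : T -> S)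
    (w : T -> nat) (g : S -> nat) :
  injective f -> (forall t, f t \in P) ->
  (forall s, s \in P -> exists t, f t = s) -> (forall t, w t = g (f t)) ->
  (\sum_t w t = \sum_(s in P) g s)%N.
Proof.
move=> f_inj fP onto wg; have -> : P = f @: T.
  apply/setP => s; apply/idP/imsetP => [/onto[t <-]|[t _ ->] //].
  by exists t.
rewrite big_imset /=; first exact: eq_bigr.
by move=> t u _ _; exact: f_inj.
Qed.

Section LatticeCongruences.
Context {d : Order.disp_t} {L : finLatticeType d}.
Local Open Scope order_scope.
Implicit Types (a b : Con (lattice_ops L)) (p u v w x y z : L).

Lemma con_refl a x : (x, x) \in con_graph a.
Proof. by case: (con_congruence a). Qed.

Lemma con_sym a x y : (x, y) \in con_graph a -> (y, x) \in con_graph a.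
Proof. by case: (con_congruence a) => _ s _ _; exact: s. Qed.

Lemma con_trans a x y z :
  (x, y) \in con_graph a -> (y, z) \in con_graph a -> (x, z) \in con_graph a.
Proof. by case: (con_congruence a) => _ _ t _; exact: t. Qed.

Lemma con_meet2 a x y z t : (x, y) \in con_graph a -> (z, t) \in con_graph a ->
  (Order.meet x z, Order.meet y t) \in con_graph a.
Proof.
move=> xy zt; case: (con_congruence a) => _ _ _.
move/(_ (meet_op L) (or_intror erefl) [tuple x; z] [tuple y; t]).
rewrite /= !(tnth_nth x) /=; apply=> i; rewrite !(tnth_nth x) /=.
by case: i => [[|[|]]].
Qed.

Lemma con_join2 a x y z t : (x, y) \in con_graph a -> (z, t) \in con_graph a ->
  (Order.join x z, Order.join y t) \in con_graph a.
Proof.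
move=> xy zt; case: (con_congruence a) => _ _ _.
move/(_ (join_op L) (or_introl erefl) [tuple x; z] [tuple y; t]).
rewrite /= !(tnth_nth x) /=; apply=> i; rewrite !(tnth_nth x) /=.
by case: i => [[|[|]]].
Qed.

Lemma con_convex a x y z : x <= y -> y <= z -> (x, z) \in con_graph a ->
  (x, y) \in con_graph a /\ (y, z) \in con_graph a.
Proof.
move=> xy yz xz.
have := con_meet2 xz (con_refl a y); rewrite (meet_l xy) (meet_r yz) => axy.
by split=> //; apply: con_trans (con_sym axy) xz.
Qed.

(** Every block has a least element, so the size of this set is the rank of [a], the number of
    elements minus the number of blocks. *)
Definition nonmin a := [set x | [exists y, (y < x) && ((x, y) \in con_graph a)]].

(** A minimal element of a block is least in it, because blocks are closed under meets. *)
Lemma block_least a x :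
  exists2 m, (x, m) \in con_graph a &
    forall y, (x, y) \in con_graph a -> m <= y.
Proof.
have [m xm min] := exists_minimal (P := fun y => (x, y) \in con_graph a) (con_refl a x).
exists m => // y xy; have := con_meet2 xm xy; rewrite meetxx => xmy.
have := contraL (min (Order.meet m y)) xmy.
by rewrite lt_neqAle leIl andbT negbK => /eqP <-; exact: leIr.
Qed.

Lemma energy_nonmin (R : realType) a : energy R a = (2 * #|nonmin a|)%:R%R.
Proof.
pose least x m := ((x, m) \in con_graph a) &&
  [forall y, ((x, y) \in con_graph a) ==> (m <= y)].
pose rep x := odflt x [pick m | least x m].
have repP x : least x (rep x).
  rewrite /rep; case: pickP => [m //|none] /=.
  have [m xm min] := block_least a x; have := none m.
  by rewrite /least xm /= => /forallP[]; move=> y; apply/implyP/min.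
have rep_rel x : (x, rep x) \in con_graph a by case/andP: (repP x).
have rep_le x y : (x, y) \in con_graph a -> rep x <= y.
  by case/andP: (repP x) => _ /forallP/(_ y)/implyP.
rewrite (@energy_rep R _ _ a rep) // => [|x y xy]; last first.
  apply: le_anti; apply/andP; split; apply: rep_le.
    exact: con_trans xy (rep_rel y).
  exact: con_trans (con_sym xy) (rep_rel x).
congr ((2 * _)%N%:R)%R; apply: eq_card => x; rewrite !inE.
apply/idP/existsP => [rx|[y /andP[yx /rep_le ry]]].
  by exists (rep x); rewrite lt_neqAle rx rep_le ?con_refl // rep_rel.
by apply: contraTneq yx => rx; rewrite le_gtF // -{1}rx.
Qed.

Lemma lattice_energy (R : realType) :
  congruence_energy R (lattice_ops L) = (2 * \sum_a #|nonmin a|)%:R%R.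
Proof.
rewrite /congruence_energy big_distrr natr_sum; apply: eq_bigr => a _.
exact: energy_nonmin.
Qed.

(** Whatever lies strictly below [p] lies below its lower cover, and blocks are convex. *)
Lemma nonmin_join_irr a p : join_irr p ->
  (p \in nonmin a) = ((lower_cover p, p) \in con_graph a).
Proof.
move=> /lower_coverP[cp cov]; rewrite inE; apply/existsP/idP.
  move=> [y /andP[yp py]].
  by have [] := con_convex (cov _ yp) (ltW cp) (con_sym py).
by move=> ap; exists (lower_cover p); rewrite cp con_sym.
Qed.

Lemma nonmin_least a z : (forall x, z <= x) -> z \notin nonmin a.
Proof.
move=> min; rewrite inE; apply/existsP => -[y /andP[yz _]].
by move: yz; rewrite le_gtF.
Qed.

(** The set [I_a] of the overview. *)
Definition collapsed_JI a := JI L :&: nonmin a.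

Lemma collapsed_JI_sub a : collapsed_JI a \in powerset (JI L).
Proof. by rewrite powersetE subsetIl. Qed.

(** Meets reduce the claim to pairs [u <= v]. If [b] fails to collapse such a pair, take [p <= v]
    minimal such that [b] separates [p] from [p /\ u]. Minimality makes [p] join irreducible, and
    [a] collapses it with the smaller [p /\ u]. So [b] collapses [p] with its lower cover, which it
    also collapses with [p /\ u], a contradiction. *)
Lemma collapsed_JI_le a b : collapsed_JI a \subset collapsed_JI b ->
  con_graph a \subset con_graph b.
Proof.
move=> /subsetP sub.
suff le_uv u v : u <= v -> (u, v) \in con_graph a -> (u, v) \in con_graph b.
  apply/subsetP => -[u v] uv.
  have := con_meet2 (con_refl a u) uv; rewrite meetxx => /con_sym a1.
  have := con_meet2 uv (con_refl a v); rewrite meetxx => a2.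
  apply: (@con_trans _ _ (Order.meet u v)).
    exact: con_sym (le_uv _ _ (leIl _ _) a1).
  exact: (le_uv _ _ (leIr _ _) a2).
move=> uv auv; apply/negbNE/negP => nuv.
pose P p := (p <= v) && ((Order.meet p u, p) \notin con_graph b).
have [|p /andP[pv pN] min] := @exists_minimal _ _ P v.
  by rewrite /P lexx (meet_r uv).
have pu : Order.meet p u < p.
  by rewrite lt_neqAle leIl andbT; apply: contraNneq pN => ->; exact: con_refl.
have below w : w < p -> (Order.meet w u, w) \in con_graph b.
  move=> wp; have := min _ wp.
  by rewrite /P (le_trans (ltW wp) pv) negbK.
have pI : join_irr p.
  apply: (join_irrI pu) => w1 w2 w1p w2p; rewrite lt_neqAle leUx !ltW // !andbT.
  apply: contraNneq pN => <-.
  have := con_join2 (below _ w1p) (below _ w2p).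
  case/(con_convex (y := Order.meet (Order.join w1 w2) u)) => //.
    rewrite leUx !lexI !leIr !andbT.
    by rewrite (le_trans (leIl _ _) (leUl _ _)) (le_trans (leIl _ _) (leUr _ _)).
  exact: leIl.
have ap : (Order.meet p u, p) \in con_graph a.
  by have := con_meet2 (con_refl a p) auv; rewrite (meet_l pv).
have : p \in collapsed_JI b.
  apply: sub; rewrite !inE pI; apply/existsP; exists (Order.meet p u).
  by rewrite pu con_sym.
rewrite inE nonmin_join_irr // => /andP[_ bp].
have [cp cov] := lower_coverP pI.
case/negP: pN; apply: con_trans bp.
suff -> : Order.meet p u = Order.meet (lower_cover p) u by exact: below.
apply: le_anti; rewrite !lexI !leIr !andbT cov //.
exact: le_trans (leIl _ _) (ltW cp).
Qed.

Lemma collapsed_JI_inj : injective collapsed_JI.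
Proof.
by move=> a b e; apply/val_inj/eqP; rewrite eqEsubset !collapsed_JI_le ?e.
Qed.

(** Meant as the congruence under which exactly the members of [I] collapse among the join
    irreducible elements. *)
Definition collapse_graph (I : {set L}) :=
  [set uv : L * L | [forall p in JI L :\: I, (p <= uv.1) == (p <= uv.2)]].

(** Compatibility with joins is where primality enters: [p <= u \/ v] then means [p <= u] or
    [p <= v]. *)
Lemma collapse_congruence (I : {set L}) :
  (forall p, join_irr p -> join_prime p) ->
  is_congruence (lattice_ops L) (collapse_graph I).
Proof.
move=> prime; split.
- by move=> x; rewrite inE; apply/forall_inP.
- move=> x y; rewrite !inE => /forall_inP xy; apply/forall_inP => p pI.
  by rewrite eq_sym xy.
- move=> x y z; rewrite !inE => /forall_inP xy /forall_inP yz.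
  by apply/forall_inP => p pI; rewrite (eqP (xy p pI)) yz.
have lexU2 p u v : p \in JI L :\: I ->
    (p <= Order.join u v) = (p <= u) || (p <= v).
  rewrite !inE => /andP[_ pI]; apply/idP/orP => [/(prime _ pI)/orP//|].
  by case=> /le_trans -> //; rewrite ?leUl ?leUr.
move=> f [->|->] s t st /=; rewrite inE; apply/forall_inP => p pI /=;
  have := st ord0; have := st ord_max; rewrite !inE /=;
  move=> /forall_inP/(_ p pI)/eqP e1 /forall_inP/(_ p pI)/eqP e0.
  by rewrite !lexU2 // e0 e1.
by rewrite !lexI e0 e1.
Qed.

(** The only join irreducible element that is below [p] but not below its lower cover is [p], so
    [collapse_graph I] identifies the two exactly when [p] is in [I]. *)
Lemma collapsed_JI_onto (I : {set L}) :
  (forall p, join_irr p -> join_prime p) -> I \subset JI L ->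
  exists a, collapsed_JI a = I.
Proof.
move=> prime /subsetP IJ.
exists (Congruence (introT (boolp.asboolP _) (collapse_congruence I prime))).
apply/setP => p; rewrite inE; have [|pI] := boolP (p \in JI L); last first.
  by apply/esym/negbTE; apply: contra pI; exact: IJ.
rewrite inE => pI; rewrite nonmin_join_irr //= inE.
have [cp cov] := lower_coverP pI.
apply/forall_inP/idP => [all_eq|pinI q] /=.
  apply/negbNE/negP => pN; have := all_eq p; rewrite !inE pN pI.
  by rewrite lexx lt_geF // => /(_ isT).
rewrite !inE => /andP[qI _]; apply/eqP; apply/idP/idP => [/le_trans -> //|qp].
  exact: ltW.
by apply: cov; rewrite lt_neqAle qp andbT; apply: contraNneq qI => ->.
Qed.

End LatticeCongruences.

(** * Sums of ranks over all congruences of a lattice *)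

Section LatticeSums.
Context {d : Order.disp_t} {L : finLatticeType d}.
Local Open Scope order_scope.
Implicit Types (a : Con (lattice_ops L)) (p u v w x y z : L) (I : {set L}).
Local Notation nonmin_sum := (\sum_(a : Con (lattice_ops L)) #|nonmin a|)%N.

Lemma least_exists z : exists m, forall w, m <= w.
Proof.
have [m _ min] := exists_minimal (P := xpredT) (u := z) isT.
exists m => w; apply: contraT => mw; suff /min : Order.meet m w < m by [].
rewrite lt_neqAle leIl andbT.
by apply: contraNneq mw => <-; exact: leIr.
Qed.

Lemma least_not_join_irr z : (forall w, z <= w) -> ~~ join_irr z.
Proof.
by move=> min; apply/existsP => -[q /andP[]]; rewrite le_gtF.
Qed.

(** In a chain all elements but the least are join irreducible, and they are join prime. So every
    set of them is [nonmin a] for exactly one [a]. *)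
Lemma nonmin_sum_chain : (0 < #|L|)%N -> is_chain L ->
  (2 * nonmin_sum = #|L|.-1 * 2 ^ #|L|.-1)%N.
Proof.
case/card_gt0P => z0 _ chain; have [m min] := least_exists z0.
have JIE : JI L = ~: [set m].
  apply/setP => p; rewrite !inE; apply/idP/idP => [|pm].
    by apply: contraTneq => ->; exact: least_not_join_irr.
  apply/negbNE/negP => /join_irrPn[pmin|[u [v [up vp uvp]]]].
    by case/eqP: pm; apply: le_anti; rewrite pmin min.
  move: up vp; rewrite -uvp.
  by case/orP: (chain u v) => [/join_r|/join_l] ->; rewrite ltxx.
have nonminE a : nonmin a = collapsed_JI a.
  apply/esym/setIidPr/subsetP => p; rewrite JIE in_setC1; apply: contraTneq => ->.
  exact: nonmin_least.
have prime p : join_irr p -> join_prime p.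
  move=> _ u v; case/orP: (chain u v) => [/join_r|/join_l] ->.
    by move=> ->; rewrite orbT.
  by move=> ->.
rewrite (@sum_bij _ _ (powerset (JI L)) collapsed_JI _ (fun I => #|I|)) //.
- by rewrite sum_card_powerset JIE cardsC1.
- exact: collapsed_JI_inj.
- exact: collapsed_JI_sub.
- by move=> I; rewrite powersetE; exact: collapsed_JI_onto.
- by move=> a; rewrite nonminE.
Qed.

Lemma antichain_lt_join u v : u >< v -> u < Order.join u v /\ v < Order.join u v.
Proof.
move=> uv; rewrite !lt_neqAle leUl leUr !andbT; split; apply: contraNneq uv => e.
  by apply/orP; right; rewrite e leUr.
by apply/orP; left; rewrite e leUl.
Qed.

Lemma antichain_neq u v : u >< v -> u != v.
Proof. by apply: contraNneq => ->; rewrite /Order.comparable lexx. Qed.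

Lemma antichain_join_notin_JI u v : u >< v -> Order.join u v \notin JI L.
Proof.
move=> /antichain_lt_join[u_lt v_lt].
by rewrite inE; apply/negP => /join_irr_join/(_ u_lt v_lt); rewrite ltxx.
Qed.

Section Antichain.
Variables u v : L.
Hypothesis uv : u >< v.
Let j := Order.join u v.
Let u_lt : u < j := (antichain_lt_join uv).1.
Let v_lt : v < j := (antichain_lt_join uv).2.
Let jN : j \notin JI L := antichain_join_notin_JI uv.
Let uv_neq : u != v := antichain_neq uv.

Lemma card_antichain_ge4 : (4 <= #|L|)%N.
Proof.
pose s := [:: Order.meet u v; u; v; j].
have s_uniq : uniq s.
  rewrite /= !inE !negb_or uv_neq (lt_eqF u_lt) (lt_eqF v_lt) !andbT /=.
  apply/and3P; split.
  - by apply: contraNneq uv => /eqP; rewrite eq_meetl => uv'; apply/orP; left.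
  - by apply: contraNneq uv => /eqP; rewrite eq_meetr => uv'; apply/orP; right.
  - by apply: contraTneq u_lt => <-; rewrite le_gtF ?leIl.
by rewrite -[4%N]/(size s) -(card_uniqP s_uniq) max_card.
Qed.

Let card_JI : (#|JI L| <= #|L| - 2)%N.
Proof.
have [m min] := least_exists u.
have sub : [set m; j] \subset ~: JI L.
  by rewrite subUset !sub1set !in_setC jN inE least_not_join_irr.
have mj : m != j by rewrite lt_eqF // (le_lt_trans (min u)).
by have := subset_leq_card sub; rewrite cards2 mj -(cardsC (JI L)) /=; lia.
Qed.

Lemma not_JI_eq x : #|JI L| = (#|L| - 2)%N -> (exists w, w < x) ->
  x \notin JI L -> x = j.
Proof.
move=> kE [w wx] xN; have [m min] := least_exists u.
have sub : [set m; j] \subset ~: JI L.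
  by rewrite subUset !sub1set !in_setC jN inE least_not_join_irr.
have mj : m != j by rewrite lt_eqF // (le_lt_trans (min u)).
have /eqP E : [set m; j] == ~: JI L.
  rewrite eqEcard sub cards2 mj /=; move: kE card_antichain_ge4.
  rewrite -(cardsC (JI L)). move: #|JI L| #|~: JI L| => k c; lia.
have : x \in ~: JI L by rewrite in_setC.
by rewrite -E !inE => /orP[/eqP xm|/eqP //]; move: wx; rewrite xm le_gtF.
Qed.

(** Both elements are strictly above [u /\ v] and differ from [j], the only reducible element that
    is not least. *)
Lemma antichain_JI : #|JI L| = (#|L| - 2)%N -> u \in JI L /\ v \in JI L.
Proof.
move=> kE; split; apply/negbNE/negP => /(not_JI_eq kE) e.
  suff uj : u = j by move: u_lt; rewrite -uj ltxx.
  apply: e; exists (Order.meet u v); rewrite lt_neqAle leIl andbT.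
  by apply: contraNneq uv => /eqP; rewrite eq_meetl => uv'; apply/orP; left.
suff vj : v = j by move: v_lt; rewrite -vj ltxx.
apply: e; exists (Order.meet u v); rewrite lt_neqAle leIr andbT.
by apply: contraNneq uv => /eqP; rewrite eq_meetr => uv'; apply/orP; right.
Qed.

(** If [j] collapses with some [w < j], then [u] or [v] is not below [w], and meeting with that
    element collapses it with something smaller. *)
Lemma nonmin_join a : j \in nonmin a -> (u \in nonmin a) || (v \in nonmin a).
Proof.
rewrite [in j \in _]inE => /existsP[w /andP[wj jw]].
have key x : x <= j -> ~~ (x <= w) -> x \in nonmin a.
  move=> xj xw; rewrite inE; apply/existsP; exists (Order.meet x w).
  rewrite lt_neqAle leIl andbT; apply/andP; split.
    by apply: contraNneq xw => <-; exact: leIr.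
  by have := con_meet2 (con_refl a x) jw; rewrite (meet_l xj).
have [uw|/key ->//] := boolP (u <= w); last exact: leUl.
have [vw|/key ->//] := boolP (v <= w); rewrite ?orbT ?leUr //.
by move: wj; rewrite le_gtF // leUx uw.
Qed.

(* The second summand is for [j], the only reducible element besides the least
   one when [#|JI L| = #|L| - 2]. *)
Definition antichain_weight I := (#|I| + ((u \in I) || (v \in I)))%N.

Lemma card_nonmin a : #|JI L| = (#|L| - 2)%N ->
  #|nonmin a| = (#|collapsed_JI a| + (j \in nonmin a))%N.
Proof.
move=> kE; rewrite -[LHS](cardsID (JI L)) setIC; congr addn.
have sub x : x \in nonmin a :\: JI L -> x = j.
  rewrite in_setD => /andP[xN]; rewrite inE => /existsP[w /andP[wx _]].
  by apply: not_JI_eq => //; exists w.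
case: (boolP (j \in nonmin a)) => jn.
  apply/eqP/cards1P; exists j; apply/setP => x; rewrite in_set1.
  by apply/idP/eqP => [/sub //|->]; rewrite in_setD jN.
apply/eqP; rewrite cards_eq0; apply/eqP/setP => x; rewrite in_set0.
apply/negP => /[dup] /sub ->; by rewrite in_setD (negPf jn) andbF.
Qed.

Lemma card_nonmin_le a : #|JI L| = (#|L| - 2)%N ->
  (#|nonmin a| <= antichain_weight (collapsed_JI a))%N.
Proof.
move=> kE; have [uJ vJ] := antichain_JI kE.
rewrite card_nonmin // leq_add2l !in_setI uJ vJ /=.
by case: (boolP (j \in _)) => // /nonmin_join ->.
Qed.

(** With [n = #|L|], the sizes give [(n - 2) 2 ^ (n - 2)]. The sets that meet [{u, v}] are three
    quarters of all, which adds [3 * 2 ^ (n - 3) = 2 ^ (n - 2) + 2 ^ (n - 3)]. *)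
Lemma sum_antichain_weight : #|JI L| = (#|L| - 2)%N ->
  (2 * \sum_(I in powerset (JI L)) antichain_weight I =
   (#|L| - 1) * 2 ^ (#|L| - 2) + 2 ^ (#|L| - 3))%N.
Proof.
move=> kE; have [uJ vJ] := antichain_JI kE.
rewrite big_split /= mulnDr sum_card_powerset kE.
have := card_powerset_pair uJ vJ uv_neq; rewrite kE.
rewrite -sum1dep_card big_mkcondr /=.
have -> : (\sum_(I in powerset (JI L)) (if (u \in I) || (v \in I) then 1 else 0)
   = \sum_(I in powerset (JI L)) ((u \in I) || (v \in I)))%N.
  by apply: eq_bigr => I _; case: (_ || _).
move: (\sum_(I in _) _)%N => s.
have := card_antichain_ge4; case: #|L| => [|[|[|[|n]]]] // _.
rewrite !subSS !subn0 !expnS; nia.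
Qed.

Lemma nonmin_sum_le :
  (2 * nonmin_sum <= (#|L| - 1) * 2 ^ (#|L| - 2) + 2 ^ (#|L| - 3))%N /\
  ((2 * nonmin_sum = (#|L| - 1) * 2 ^ (#|L| - 2) + 2 ^ (#|L| - 3))%N ->
   #|JI L| = (#|L| - 2)%N /\
   forall I, I \subset JI L -> I != set0 ->
     exists2 a, I = collapsed_JI a & #|nonmin a| = antichain_weight I).
Proof.
have [kE|kN] := eqVneq #|JI L| (#|L| - 2)%N.
  have [le_w eq_w] := leq_sum_inj (g := antichain_weight) collapsed_JI_inj
    collapsed_JI_sub (fun a => card_nonmin_le a kE).
  rewrite -(sum_antichain_weight kE); split=> [|e]; first by rewrite leq_mul2l.
  split=> // I IJ I0; apply: eq_w; rewrite ?powersetE //.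
    by move/eqP: e; rewrite eqn_pmul2l // => /eqP.
  by rewrite /antichain_weight addn_gt0 card_gt0 I0.
(* Now [#|JI L| <= #|L| - 3], so there are at most [2 ^ (#|L| - 3)] congruences; the bottom has rank
   0 and the others at most [#|L| - 1]. *)
suff: (2 * nonmin_sum < (#|L| - 1) * 2 ^ (#|L| - 2) + 2 ^ (#|L| - 3))%N by lia.
have cardC : (#|{: Con (lattice_ops L)}| <= 2 ^ #|JI L|)%N.
  rewrite -card_powerset -(card_imset _ collapsed_JI_inj).
  by apply/subset_leq_card/subsetP => _ /imsetP[x _ ->]; exact: collapsed_JI_sub.
have sum_le : (nonmin_sum <= #|{: Con (lattice_ops L)}|.-1 * (#|L| - 1))%N.
  pose bot : Con (lattice_ops L) := \bot.
  rewrite (bigD1 bot) //= (_ : #|nonmin bot| = 0)%N; last first.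
    apply/eqP; rewrite cards_eq0; apply/eqP/setP => x; rewrite !inE.
    apply/existsP => -[y /andP[yx]]; rewrite inE /= => /eqP xy.
    by move: yx; rewrite xy ltxx.
  rewrite add0n -(cardC1 bot) -sum_nat_const.
  apply: leq_sum => a _; have [m min] := least_exists u.
  rewrite subn1 -(cardsC1 m); apply/subset_leq_card/subsetP => x.
  by rewrite !inE; apply: contraTneq => ->; have := nonmin_least a min; rewrite inE.
have := card_antichain_ge4; move: kN card_JI cardC sum_le.
case: #|L| => [|[|[|[|n]]]] //; rewrite !subSS !subn0 => kN k_le cardC sum_le _.
have {}cardC : (#|{: Con (lattice_ops L)}| <= 2 ^ n.+1)%N.
  by apply: leq_trans cardC _; rewrite leq_exp2l //; lia.
move: cardC sum_le; rewrite !expnS; have := expn_gt0 2 n.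
move: (2 ^ n)%N => e; move: #|_| => c; move: nonmin_sum => s; nia.
Qed.

End Antichain.

(** For [x] among [u] and [v], equality yields a congruence with [I_a = {x}] and rank 2, so it also
    collapses [u \/ v]. As [u' \/ v'] is the same reducible element, [u'] or [v'] is collapsed,
    hence equal to [x]. *)
Lemma nonmin_sum_eq_unique u v u' v' : u >< v -> u' >< v' ->
  (2 * nonmin_sum = (#|L| - 1) * 2 ^ (#|L| - 2) + 2 ^ (#|L| - 3))%N ->
  [set u'; v'] = [set u; v].
Proof.
move=> uv uv' e; have [_ /(_ e)[kE real]] := nonmin_sum_le uv.
have [uJ vJ] := antichain_JI uv kE; have [uJ' vJ'] := antichain_JI uv' kE.
have key x : x \in JI L -> (x == u) || (x == v) -> (x == u') || (x == v').
  move=> xJ xuv; have [||a Ia nE] := real [set x].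
  - by rewrite sub1set.
  - by apply/set0Pn; exists x; rewrite inE.
  have memE y : y \in JI L -> (y \in nonmin a) = (y == x).
    by move=> yJ; move/setP/(_ y): Ia; rewrite in_set1 in_setI yJ.
  have jn : Order.join u v \in nonmin a.
    have := card_nonmin uv a kE; rewrite nE -Ia /antichain_weight !in_set1.
    by rewrite ![_ == x]eq_sym xuv => /addnI; case: (_ \in nonmin a).
  have jE : Order.join u' v' = Order.join u v.
    apply: (not_JI_eq uv kE); last exact: antichain_join_notin_JI.
    by exists u'; have [] := antichain_lt_join uv'.
  rewrite -jE in jn; have := nonmin_join jn.
  by rewrite !memE // ![x == _]eq_sym.
have := key u uJ; have := key v vJ; rewrite !eqxx orbT => /(_ isT) v1 /(_ isT) u1.
apply/esym/eqP; rewrite eqEcard subUset !sub1set !inE u1 v1 !cards2.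
by rewrite (antichain_neq uv) (antichain_neq uv').
Qed.

(** Uniqueness makes all join irreducible elements prime, so every [I] occurs as some [I_a]. It also
    leaves only [j] and the least element reducible, and makes [j] collapse as soon as [u] or [v]
    does, so each rank equals its weight. *)
Lemma nonmin_sum_unique u v : u >< v ->
  (forall u' v', u' >< v' -> [set u'; v'] = [set u; v]) ->
  (2 * nonmin_sum = (#|L| - 1) * 2 ^ (#|L| - 2) + 2 ^ (#|L| - 3))%N.
Proof.
move=> uv uniq_uv; pose j := Order.join u v.
have incE w z : w >< z -> w = u /\ z = v \/ w = v /\ z = u.
  move=> wz; have := uniq_uv _ _ wz; have := antichain_neq wz.
  move=> wz_neq /setP e; have := e w; have := e z; rewrite !inE !eqxx orbT /=.
  move=> /esym/orP[] /eqP ez /esym/orP[] /eqP ew; rewrite ?ez ?ew ?eqxx in wz_neq *;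
    by [left|right].
have prime p : join_irr p -> join_prime p.
  move=> pI x y; have [|] := boolP (x >=< y).
    by case/orP => [/join_r|/join_l] -> ->; rewrite ?orbT.
  move=> xy pxy; have {}pxy : p <= j.
    by case: (incE _ _ xy) pxy => -[-> ->] //; rewrite joinC.
  suff : (p <= u) || (p <= v) by case: (incE _ _ xy) => -[-> ->] //; rewrite orbC.
  (* An element below neither [u] nor [v] differs from both, so it is comparable with both and lies
     above them. Then [p = j], which is reducible. *)
  apply/negbNE/negP; rewrite negb_or => /andP[pu pv].
  have up : u <= p.
    apply: contraT => up; have pu' : p >< u by rewrite /Order.comparable negb_or pu.
    by case: (incE _ _ pu') => -[e _]; rewrite e lexx in pu pv.
  have vp : v <= p.
    apply: contraT => vp; have pv' : p >< v by rewrite /Order.comparable negb_or pv.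
    by case: (incE _ _ pv') => -[e _]; rewrite e lexx in pu pv.
  have pj : p = j by apply: le_anti; rewrite pxy leUx up.
  by have := antichain_join_notin_JI uv; rewrite inE -/j -pj pI.
have [m min] := least_exists u; have [u_lt v_lt] := antichain_lt_join uv.
have JIE : JI L = ~: [set m; j].
  apply/setP => p; rewrite !inE; apply/idP/idP => [|].
    apply: contraTN => /orP[] /eqP ->; first exact: least_not_join_irr.
    by have := antichain_join_notin_JI uv; rewrite inE.
  apply: contraNT => /join_irrPn[pmin|[x [y [xp yp xyp]]]].
    by apply/orP; left; apply/eqP/le_anti; rewrite pmin min.
  apply/orP; right; apply/eqP; have [|xy] := boolP (x >=< y).
    by case/orP => [/join_r|/join_l] e; move: xp yp; rewrite -xyp e ltxx.
  by rewrite -xyp; case: (incE _ _ xy) => -[-> ->] //; rewrite joinC.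
have mj : m != j by rewrite lt_eqF // (le_lt_trans (min u)).
have kE : #|JI L| = (#|L| - 2)%N.
  by rewrite JIE -(cardsC [set m; j]) cards2 mj addKn.
(* If [x] collapses with [w < x], then [w] is comparable with [y] by uniqueness, and [w <= y] since
   [y <= w] would give [y < x]. Joining with [y] collapses [x \/ y] with [y]. *)
have key a x y : x >< y -> x \in nonmin a -> Order.join x y \in nonmin a.
  move=> xy; rewrite !inE => /existsP[w /andP[wx xw]]; apply/existsP; exists y.
  have wy : w <= y.
    apply: contraT => wy; have [yw|yw] := boolP (y <= w).
      by case/negP: xy; apply/orP; right; exact: le_trans yw (ltW wx).
    have wy' : w >< y by rewrite /Order.comparable negb_or wy.
    have := uniq_uv _ _ wy'; rewrite -(uniq_uv _ _ xy) => /setP/(_ w).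
    rewrite !inE eqxx => /esym/orP[] /eqP e; last by rewrite e lexx in wy.
    by rewrite e ltxx in wx.
  have [_ ->] := antichain_lt_join xy.
  by have := con_join2 xw (con_refl a y); rewrite (join_r wy).
rewrite -(sum_antichain_weight uv kE); congr (2 * _)%N.
have [uJ vJ] := antichain_JI uv kE.
apply: (sum_bij collapsed_JI_inj collapsed_JI_sub) => [I|a].
  by rewrite powersetE; exact: collapsed_JI_onto.
rewrite (card_nonmin uv a kE) /antichain_weight !in_setI uJ vJ /=; congr (_ + nat_of_bool _)%N.
apply/idP/orP => [/nonmin_join/orP //|[/key-> //|]].
by rewrite joinC => /key -> //; rewrite comparable_sym.
Qed.

End LatticeSums.

(** * Lattices with a unique antichain as glued sums *)

Definition unique_antichain d (L : finLatticeType d) (u v : L) :=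
  (u >< v)%O /\
  forall u' v' : L, (u' >< v')%O -> [set u'; v'] = [set u; v].

Lemma unique_antichainP d (L : finLatticeType d) :
  (exists! X : {set L}, antichain2 X) <->
  exists u v : L, unique_antichain u v.
Proof.
split=> [[_ [[u [v [uv ->]]] uniq]]|[u [v [uv uniq]]]].
  by exists u, v; split=> // u' v' uv'; apply/esym/uniq; exists u', v'.
exists [set u; v]; split; first by exists u, v.
by move=> _ [u' [v' [uv' ->]]]; apply/esym/uniq.
Qed.

Section Interval.
Context (d : Order.disp_t) (L : finLatticeType d) (lo hi : L).
Hypothesis lo_hi : (lo <= hi)%O.
Local Open Scope order_scope.

(** The proof of [lo <= hi] is a parameter of the type, so that bottom and top can be attached to it
    as instances. *)
Definition interval of lo <= hi := {z : L | (lo <= z) && (z <= hi)}.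
Local Notation I := (interval lo_hi).

HB.instance Definition _ := SubFinite.on I.

Fact interval_display : Order.disp_t. Proof. exact: Order.Disp tt tt. Qed.

HB.instance Definition _ := [SubChoice_isSubPOrder of I by <: with interval_display].

Definition to_interval z (zP : (lo <= z) && (z <= hi)) : I :=
  exist (fun z => (lo <= z) && (z <= hi)) z zP.

Fact interval_meet_subproof (x y : I) :
  (lo <= Order.meet (val x) (val y)) && (Order.meet (val x) (val y) <= hi).
Proof.
case: x y => [x /= /andP[lx xh]] [y /= /andP[ly _]].
by rewrite lexI lx ly (le_trans (leIl _ _) xh).
Qed.

Fact interval_join_subproof (x y : I) :
  (lo <= Order.join (val x) (val y)) && (Order.join (val x) (val y) <= hi).
Proof.
case: x y => [x /= /andP[lx xh]] [y /= /andP[_ yh]].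
by rewrite leUx xh yh (le_trans lx (leUl _ _)).
Qed.

Definition interval_meet (x y : I) : I := to_interval (interval_meet_subproof x y).
Definition interval_join (x y : I) : I := to_interval (interval_join_subproof x y).

Fact interval_meetP (x y z : I) : (x <= interval_meet y z) = (x <= y) && (x <= z).
Proof. by rewrite !leEsub /= lexI. Qed.

Fact interval_joinP (x y z : I) : (interval_join x y <= z) = (x <= z) && (y <= z).
Proof. by rewrite !leEsub /= leUx. Qed.

HB.instance Definition _ := Order.POrder_MeetJoin_isLattice.Build
  interval_display I interval_meetP interval_joinP.

Fact interval_bot_subproof : (lo <= lo) && (lo <= hi).
Proof. by rewrite lexx. Qed.

Fact interval_top_subproof : (lo <= hi) && (hi <= hi).
Proof. by rewrite lexx andbT. Qed.

Fact interval_botP (x : I) : to_interval interval_bot_subproof <= x.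
Proof. by rewrite leEsub /=; case/andP: (valP x). Qed.

Fact interval_topP (x : I) : x <= to_interval interval_top_subproof.
Proof. by rewrite leEsub /=; case/andP: (valP x). Qed.

HB.instance Definition _ := Order.hasBottom.Build interval_display I interval_botP.
HB.instance Definition _ := Order.hasTop.Build interval_display I interval_topP.

End Interval.


Section OrderIsomorphism.
Context (d : Order.disp_t) (L : finLatticeType d).
Context (d' : Order.disp_t) (K : latticeType d').
Local Open Scope order_scope.

(** An order isomorphism preserves meets and joins. The map goes from [K] to [L] because maps out of
    a glued sum are easily given by cases. *)
Lemma lattice_isomorphic_from (g : K -> L) :
  {mono g : x y / x <= y} -> (forall z, exists x, g x = z) ->
  lattice_isomorphic L K.
Proof.
move=> g_mono /fin_all_exists[f fK].
have gK : cancel g f by move=> x; apply: (inc_inj g_mono); rewrite fK.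
exists f; split; first by exists g.
  move=> x y; apply: (inc_inj g_mono); rewrite fK; apply: le_anti.
  rewrite -[in X in X && _](fK (Order.meet x y)) g_mono lexI -!g_mono !fK.
  rewrite leIl leIr lexI /=.
  by rewrite -[X in _ <= X](fK x) -[X in _ && (_ <= X)](fK y) !g_mono leIl leIr.
move=> x y; apply: (inc_inj g_mono); rewrite fK; apply: le_anti.
rewrite leUx -[X in (X <= _) && _ && _](fK x) -[X in _ && (X <= _) && _](fK y).
rewrite !g_mono leUl leUr /=.
by rewrite -(fK (Order.join x y)) g_mono leUx -!g_mono !fK leUl leUr.
Qed.

Lemma lattice_isomorphic_mono : lattice_isomorphic L K ->
  exists2 f : L -> K, bijective f & {mono f : x y / x <= y}.
Proof.
case=> f [f_bij fI _]; exists f => // x y.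
by rewrite -eq_meetl -fI (bij_eq f_bij) eq_meetl.
Qed.

End OrderIsomorphism.

Section GluedChains.
Context (d1 d2 : Order.disp_t).
Context (C1 : finTBLatticeType d1) (C2 : finTBLatticeType d2).
Local Notation G := (C1 +glu B4 +glu C2)%type.

(** The images of the two atoms of [B4]. *)
Definition glued_left : G := inl (glued_inr C1 ((true, false) : B4)).
Definition glued_right : G := inl (glued_inr C1 ((false, true) : B4)).

(** Elements of different summands are comparable and the outer summands are chains, so both
    elements of an antichain come from [B4]. *)
Lemma glued_unique_antichain : is_chain C1 -> is_chain C2 ->
  (glued_left >< glued_right)%O /\
  forall p q : G, (p >< q)%O ->
    (p = glued_left /\ q = glued_right) \/ (p = glued_right /\ q = glued_left).
Proof.
move=> chain1 chain2; split.
  rewrite /glued_left /glued_right.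
  case: glued_inrP => // -[[[] []] /= ?] //.
  by case: glued_inrP => // -[[[] []] /= ?].
have eqL (s : {v : B4 | v != \bot%O}) : val s = (true, false) :> B4 ->
    inl (inr s) = glued_left.
  move=> e; rewrite /glued_left; case: glued_inrP => // s' e'.
  by congr (inl (inr _)); apply: val_inj; rewrite e.
have eqR (s : {v : B4 | v != \bot%O}) : val s = (false, true) :> B4 ->
    inl (inr s) = glued_right.
  move=> e; rewrite /glued_right; case: glued_inrP => // s' e'.
  by congr (inl (inr _)); apply: val_inj; rewrite e.
case=> [[x|s]|x] [[y|t]|y] //.
- by move/negP; case; exact: chain1.
- move=> st; have := eqL s; have := eqL t; have := eqR s; have := eqR t.
  move: s t st => -[[[] []] /= ?] -[[[] []] /= ?] //.
    by move=> _ /(_ erefl) -> _ _ /(_ erefl) ->; left.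
  by move=> _ _ /(_ erefl) -> /(_ erefl) -> _; right.
- by move/negP; case; exact: chain2.
Qed.

End GluedChains.

Section GluedInterval.
Context (d : Order.disp_t) (L : finLatticeType d) (u v : L).
Hypothesis uv_uniq : unique_antichain u v.
Local Open Scope order_scope.
Let m := Order.meet u v.
Let j := Order.join u v.

Let uv : u >< v := uv_uniq.1.

Let uvN : ((u <= v) = false) * ((v <= u) = false).
Proof. by move: uv; rewrite negb_or => /andP[/negPf-> /negPf->]. Qed.

Let comparable_outside x y : x != u -> x != v -> x >=< y.
Proof.
move=> xu xv; apply: contraT => xy; have := uv_uniq.2 _ _ xy.
by move=> /setP/(_ x); rewrite !inE eqxx (negPf xu) (negPf xv).
Qed.

Let chain_below x y : x <= m -> x >=< y.
Proof.
rewrite lexI => /andP[xu xv]; apply: comparable_outside.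
  by apply: contraTneq xv => ->; rewrite uvN.
by apply: contraTneq xu => ->; rewrite uvN.
Qed.

Let chain_above x y : j <= x -> x >=< y.
Proof.
rewrite leUx => /andP[ux vx]; apply: comparable_outside.
  by apply: contraTneq vx => ->; rewrite uvN.
by apply: contraTneq ux => ->; rewrite uvN.
Qed.

(** Apart from [u] and [v] themselves, every element is comparable with both, and it cannot lie
    between them. *)
Let glued_cases x : [\/ x <= m, x = u, x = v | j <= x].
Proof.
have [->|xu] := eqVneq x u; first exact: Or42.
have [->|xv] := eqVneq x v; first exact: Or43.
have /orP[xu'|xu'] := comparable_outside u xu xv;
  have /orP[xv'|xv'] := comparable_outside v xu xv.
- by apply: Or41; rewrite lexI xu'.
- by have := le_trans xv' xu'; rewrite uvN.
- by have := le_trans xu' xv'; rewrite uvN.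
- by apply: Or44; rewrite leUx xu'.
Qed.

(** The chains are the intervals from the least element to [u /\ v] and from [u \/ v] to the
    greatest one. The four elements [u /\ v], [u], [v], [u \/ v] form the copy of [B4]. *)
Lemma glued_interval : exists (d1 d2 : Order.disp_t)
  (C1 : finTBLatticeType d1) (C2 : finTBLatticeType d2),
  [/\ is_chain C1, is_chain C2
    & lattice_isomorphic L (C1 +glu B4 +glu C2)%type].
Proof.
have [b b_min] := least_exists u.
have [t t_max] : exists t : L, forall x, x <= t := @least_exists _ L^d u.
exists interval_display, interval_display, (interval (b_min m)), (interval (t_max j)).
have val1 (x : interval (b_min m)) : val x <= m by case/andP: (valP x).
have val2 (x : interval (t_max j)) : j <= val x by case/andP: (valP x).
split.
- by move=> x y; rewrite /Order.comparable !leEsub; exact: chain_below.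
- by move=> x y; rewrite /Order.comparable !leEsub; exact: chain_above.
pose mid (w : B4) : L := match w with
  | (true, true) => j | (true, false) => u | (false, true) => v
  | (false, false) => m end.
pose g (p : (interval (b_min m) +glu B4 +glu interval (t_max j))%type) : L :=
  match p with
  | inl (inl x) => val x | inl (inr w) => mid (val w) | inr y => val (val y)
  end.
have mj : m < j.
  rewrite lt_neqAle (le_trans (leIl _ _) (leUl _ _)) andbT.
  apply: contraFneq uvN.1 => e; apply: le_trans (leUl u v) _.
  by rewrite -/j -e leIr.
have mid_gt (w : {w : B4 | w != \bot}) : m < mid (val w).
  case: w => -[[] []] //= _.
    by rewrite lt_neqAle leIl andbT eq_meetl uvN.
  by rewrite lt_neqAle leIr andbT eq_meetr uvN.
have mid_le (w : B4) : mid w <= j.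
  by case: w => -[] [] //=; rewrite ?leUl ?leUr // ltW.
have above_gt (x : {x : interval (t_max j) | x != \bot}) : j < val (val x).
  case: x => x /= x0; rewrite lt_neqAle val2 andbT eq_sym.
  by apply: contraNneq x0 => xj; apply/eqP/val_inj.
apply: (@lattice_isomorphic_from _ _ _ _ g).
  case=> [[x|w]|x] [[y|w']|y]; rewrite /g.
  - by rewrite -leEsub.
  - by rewrite (le_trans (val1 x)) // ltW.
  - by rewrite (le_trans (val1 x)) // (le_trans (ltW mj)) // ltW.
  - by rewrite lt_geF // (le_lt_trans (val1 y)).
  - rewrite -[RHS]/(val w <= val w').
    by case: w w' => -[[] []] //= _ [[[] []] /= _] //;
      rewrite ?lexx ?leUl ?leUr ?uvN // /j leUx ?lexx uvN ?andbF.
  - by rewrite (le_trans (mid_le _)) // ltW.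
  - by rewrite lt_geF // (le_lt_trans (val1 y)) // (lt_trans mj).
  - by rewrite lt_geF // (le_lt_trans (mid_le _)).
  - by rewrite -leEsub.
move=> x; case: (glued_cases x) => [xm|->|->|jx].
- have xP : (b <= x) && (x <= m) by rewrite b_min.
  by exists (inl (inl (to_interval (b_min m) xP))).
- by exists (inl (inr (exist (fun w : B4 => w != \bot) (true, false) isT))).
- by exists (inl (inr (exist (fun w : B4 => w != \bot) (false, true) isT))).
(* In the glued sum [j] is the top of [B4], not the removed bottom of the upper chain. *)
have [<-|jx'] := eqVneq j x.
  by exists (inl (inr (exist (fun w : B4 => w != \bot) (true, true) isT))).
have xP : (j <= x) && (x <= t) by rewrite jx t_max.
have x0 : to_interval (t_max j) xP != \bot.
  by apply: contraNneq jx' => /(congr1 val) /= ->.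
by exists (inr (exist (fun y : interval (t_max j) => y != \bot) _ x0)).
Qed.

End GluedInterval.

Lemma unique_antichain_glued d (L : finLatticeType d)
    d1 d2 (C1 : finTBLatticeType d1) (C2 : finTBLatticeType d2) :
  is_chain C1 -> is_chain C2 ->
  lattice_isomorphic L (C1 +glu B4 +glu C2)%type ->
  exists u v : L, unique_antichain u v.
Proof.
move=> chain1 chain2 /lattice_isomorphic_mono[f [f' fK f'K] f_mono].
have [lr uniq] := glued_unique_antichain chain1 chain2.
have compE x y : (x >< y)%O = (f x >< f y)%O by rewrite /Order.comparable !f_mono.
exists (f' (glued_left C1 C2)), (f' (glued_right C1 C2)).
split=> [|x y]; first by rewrite compE !f'K.
rewrite compE -{2}[x]fK -{2}[y]fK => /uniq[] [-> ->] //.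
by rewrite setUC.
Qed.

(** * Congruence energy *)

Local Open Scope ring_scope.

Section GeneralAlgebra.
Context (A : finType) (F : operation A -> Prop).
Implicit Types a b : Con F.

(** In a general algebra the enumeration of [A] supplies the representatives; the size is again the
    rank of [a]. *)
Definition nonfirst a :=
  [set x | [exists y, (enum_rank y < enum_rank x)%N && ((x, y) \in con_graph a)]].

Lemma energy_nonfirst (R : realType) a : energy R a = (2 * #|nonfirst a|)%:R.
Proof.
have [ar as_ at_ _] := con_congruence a.
pose rep x := [arg min_(y < x | (x, y) \in con_graph a) enum_rank y : nat]%N.
have rep_rel x : (x, rep x) \in con_graph a.
  by rewrite /rep; case: arg_minnP.
have rep_le x y : (x, y) \in con_graph a -> (enum_rank (rep x) <= enum_rank y)%N.
  by rewrite /rep; case: arg_minnP => // z _; apply.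
rewrite (@energy_rep R _ _ a rep) // => [|x y xy]; last first.
  apply/enum_rank_inj/ord_inj/eqP; rewrite eqn_leq; apply/andP; split; apply: rep_le.
    exact: at_ xy (rep_rel y).
  exact: at_ (as_ _ _ xy) (rep_rel x).
congr (2 * _)%N%:R; apply: eq_card => x; rewrite !inE.
apply/idP/existsP => [rx|[y /andP[yx /rep_le ry]]].
  exists (rep x); rewrite rep_rel andbT ltn_neqAle rep_le // andbT.
  by rewrite (inj_eq (@ord_inj _)) (inj_eq enum_rank_inj).
by apply: contraTneq yx => rx; rewrite -leqNgt -{1}rx.
Qed.

Lemma congruence_energy_nonfirst (R : realType) :
  congruence_energy R F = (2 * \sum_a #|nonfirst a|)%:R.
Proof.
rewrite /congruence_energy big_distrr natr_sum; apply: eq_bigr => a _.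
exact: energy_nonfirst.
Qed.

(** A pair in [b] but not in [a] may be replaced by the first elements of its two blocks of [a]. The
    later of these is not first in its block of [b]. *)
Lemma card_nonfirst_lt : {homo (fun a => #|nonfirst a|) : a b / (a < b)%O >-> (a < b)%N}.
Proof.
move=> a b; rewrite lt_neqAle => /andP[ab /subsetP le_ab].
have [ar as_ at_ _] := con_congruence a; have [br bs bt _] := con_congruence b.
apply: proper_card; apply/properP; split.
  apply/subsetP => x; rewrite !inE => /existsP[y /andP[yx xy]].
  by apply/existsP; exists y; rewrite yx le_ab.
have /subsetPn[[u v] uvb uva] : ~~ (con_graph b \subset con_graph a).
  apply: contra ab => ba; rewrite -(inj_eq val_inj) eqEsubset ba.
  by apply/andP; split=> //; apply/subsetP.
have first x : exists2 y, (x, y) \in con_graph a & y \notin nonfirst a.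
  case: (@arg_minnP _ x (fun y => (x, y) \in con_graph a) (fun y => enum_rank y : nat)) => //.
  move=> y xy min; exists y => //; rewrite inE; apply/existsP => -[z /andP[zy yz]].
  by have := min _ (at_ _ _ _ xy yz); rewrite leqNgt zy.
have [u' uu' u'N] := first u; have [v' vv' v'N] := first v.
have uv'a : (u', v') \notin con_graph a.
  by apply: contra uva => uv'; apply: at_ uu' (at_ _ _ _ uv' (as_ _ _ vv')).
have uv'b : (u', v') \in con_graph b.
  by apply: bt (bs _ _ (le_ab _ uu')) (bt _ _ _ uvb (le_ab _ vv')).
have [lt|lt|/ord_inj/enum_rank_inj e] := ltngtP (enum_rank u') (enum_rank v').
- by exists v' => //; rewrite inE; apply/existsP; exists u'; rewrite lt bs.
- by exists u' => //; rewrite inE; apply/existsP; exists v'; rewrite lt.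
- by case/negP: uv'a; rewrite e.
Qed.

Lemma card_nonfirst_bot : #|nonfirst \bot%O| = 0%N.
Proof.
apply/eqP; rewrite cards_eq0; apply/eqP/setP => x; rewrite !inE.
apply/existsP => -[y /andP[+]]; rewrite inE /= => + /eqP xy.
by rewrite xy ltnn.
Qed.

Lemma card_nonfirst_le a : (0 < #|A|)%N -> (#|nonfirst a| <= #|A|.-1)%N.
Proof.
move=> A_gt0; pose x0 := enum_val (Ordinal A_gt0).
rewrite -(cardsC1 x0); apply/subset_leq_card/subsetP => x; rewrite !inE.
by apply: contraTneq => ->; apply/existsP => -[y]; rewrite enum_valK.
Qed.

End GeneralAlgebra.

(** * The bounds as natural numbers, and the three assertions *)

Lemma g_mx_nat (R : realType) n : (0 < n)%N ->
  g_mx R n = (n.-1 * 2 ^ n.-1)%:R.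
Proof.
case: n => // n _; rewrite /g_mx natrM natrX -natr1 addrK.
by have -> : n.+1%:Z - 1 = n%:Z by lia.
Qed.

Lemma g_sb_nat (R : realType) n : (4 <= n)%N ->
  g_sb R n = ((n - 1) * 2 ^ (n - 2) + 2 ^ (n - 3))%:R.
Proof.
case: n => [|[|[|[|n]]]] // _; rewrite /g_sb natrD natrM !natrX !subSS !subn0.
have -> : n.+4%:Z - 2 = n.+2%:Z by lia.
have -> : n.+4%:Z - 3 = n.+1%:Z by lia.
by rewrite -[n.+4%:R]natr1 addrK.
Qed.

Theorem theorem7p1 (R : realType) (n : nat) (n_gt0 : (0 < n)%N) :
  (forall (A : finType) (F : operation A -> Prop),
     #|A| = n -> congruence_distributive F ->
     congruence_energy R F <= g_mx R n /\
     (congruence_energy R F = g_mx R n ->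
      boolean_lattice (Con F) /\ #|{: Con F}| = (2 ^ n.-1)%N)) /\
  (forall (d : Order.disp_t) (L : finLatticeType d),
     #|L| = n ->
     congruence_energy R (lattice_ops L) <= g_mx R n /\
     (congruence_energy R (lattice_ops L) = g_mx R n <-> is_chain L)) /\
  (forall (d : Order.disp_t) (L : finLatticeType d),
     #|L| = n -> congruence_energy R (lattice_ops L) < g_mx R n ->
     [/\ (4 <= n)%N,
         congruence_energy R (lattice_ops L) <= g_sb R n,
         congruence_energy R (lattice_ops L) = g_sb R n <->
           (exists! X : {set L}, antichain2 X)
       & congruence_energy R (lattice_ops L) = g_sb R n <->
           exists (d1 d2 : Order.disp_t)
             (C1 : finTBLatticeType d1) (C2 : finTBLatticeType d2),
             [/\ is_chain C1, is_chain C2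
               & lattice_isomorphic L (C1 +glu B4 +glu C2)%type]]).
Proof.
(* A lattice is a chain and attains [g_mx], or it has an antichain and stays within [g_sb], which is
   smaller than [g_mx]. *)
have chain_or d (L : finLatticeType d) : is_chain L \/ exists u v : L, (u >< v)%O.
  have [/existsP[u /existsP[v uv]]|no] := boolP [exists u : L, [exists v : L, (u >< v)%O]].
    by right; exists u, v.
  left=> x y; apply: contraT => xy; case/negP: no.
  by apply/existsP; exists x; apply/existsP; exists y.
have chainE d (L : finLatticeType d) : #|L| = n -> is_chain L ->
    congruence_energy R (lattice_ops L) = g_mx R n.
  move=> cardL chain; rewrite lattice_energy nonmin_sum_chain ?cardL //.
  by rewrite g_mx_nat.
have nonchain d (L : finLatticeType d) (u v : L) : #|L| = n -> (u >< v)%O ->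
    [/\ (4 <= n)%N, congruence_energy R (lattice_ops L) <= g_sb R n
      & g_sb R n < g_mx R n].
  move=> cardL uv; have n4 : (4 <= n)%N by rewrite -cardL (card_antichain_ge4 uv).
  split=> //.
    by rewrite lattice_energy g_sb_nat // ler_nat -cardL; case: (nonmin_sum_le uv).
  rewrite g_sb_nat // g_mx_nat // ltr_nat.
  case: {cardL chainE n_gt0} n n4 => [|[|[|[|k]]]] // _.
  rewrite !subSS !subn0 /= !expnS; have := expn_gt0 2 k; nia.
split; [|split] => [A F cardA distr|d L cardL|d L cardL].
- have [|le_r eq_r] := @sum_rank_distributive _ (Con F) (fun a => #|nonfirst a|)
    n.-1 distr (@card_nonfirst_lt _ _) (card_nonfirst_bot _) _.
    by rewrite -cardA card_nonfirst_le ?cardA.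
  rewrite congruence_energy_nonfirst g_mx_nat // ler_nat; split=> // /eqP.
  by rewrite eqr_nat => /eqP.
- have [chain|[u [v uv]]] := chain_or _ L.
    by rewrite chainE.
  have [_ le_sb lt_mx] := nonchain _ _ _ _ cardL uv.
  have lt := le_lt_trans le_sb lt_mx; split; first exact: ltW.
  split=> [e|/(_ u v) uv']; first by rewrite e ltxx in lt.
  by rewrite uv' in uv.
have [chain|[u [v uv]]] := chain_or _ L; first by rewrite chainE ?ltxx.
have [n4 le_sb _ _] := nonchain _ _ _ _ cardL uv.
have sbE : congruence_energy R (lattice_ops L) = g_sb R n <->
    exists u v : L, unique_antichain u v.
  rewrite lattice_energy g_sb_nat // -cardL; split.
    move=> /eqP; rewrite eqr_nat => /eqP e; exists u, v; split=> // u' v' uv'.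
    exact: nonmin_sum_eq_unique uv uv' e.
  by case=> u' [v' [uv' uniq]]; congr (_%:R); exact: nonmin_sum_unique uv' uniq.
split=> //; first by rewrite sbE unique_antichainP.
rewrite sbE; split=> [[u' [v' /glued_interval]] //|].
by case=> d1 [d2 [C1 [C2 [c1 c2 iso]]]]; exact: unique_antichain_glued iso.
Qed.
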